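(* Let $a,b\in\mathbb{C}$, let $m,n\ge 1$ be integers and let $1\le k\le m+n-1$. For every left $H_m$-module $M$ and every left $H_n$-module $N$ there is an isomorphism of $H_k\otimes H_{m+n-k}$-modules $$ (M \boxtimes N) \big\downarrow_{H_k \otimes H_{m+n - k}}^{H_{m+n}} \;\cong\; \bigoplus_{\substack{t + s = k \\ t \le m,\ s \le n }} \mathtt{T}_{t,s} \left( M\big\downarrow^{H_m}_{H_t \otimes H_{m-t}} \otimes \, N\big\downarrow^{H_n}_{H_s \otimes H_{n-s}} \right) \Big\uparrow^{H_k \otimes H_{m+n-k}}_{H_t \otimes H_s \otimes H_{m-t} \otimes H_{n-s}}, $$ where the sum is over integers $t,s\ge 0$ satisfying the indicated conditions, $M \boxtimes N= (M \otimes N) \big\uparrow_{H_m \otimes H_n}^{H_{m+n}}$, and $$\mathtt{T}_{t,s}: \mathrm{mod}(H_t \otimes H_{m-t} \otimes H_s \otimes H_{n-s}) \to \mathrm{mod}(H_t \otimes H_s \otimes H_{m-t} \otimes H_{n-s})$$ is the functor sending $M_1 \otimes M_2 \otimes N_1 \otimes N_2$ to $M_1 \otimes N_1 \otimes M_2 \otimes N_2$.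
   Context: Here the ground ring is $\mathbb{C}$ and all unadorned tensor products are over $\mathbb{C}$. For $n\ge 1$, $H_n:=H_{\mathfrak{S}_n}(a,b)$ is the unital $\mathbb{C}$-algebra generated by $\pi_1,\dots,\pi_{n-1}$ with relations $\pi_i^2=a\pi_i+b$, $\pi_i\pi_{i+1}\pi_i=\pi_{i+1}\pi_i\pi_{i+1}$, and $\pi_i\pi_j=\pi_j\pi_i$ for $|i-j|\ge 2$; $H_0:=\mathbb{C}$. For $p,q\ge 0$, $H_p\otimes H_q$ is identified with the subalgebra of $H_{p+q}$ generated by $\pi_i$, $i\ne p$, via $\pi_i\otimes 1\mapsto \pi_i$ and $1\otimes\pi_j\mapsto\pi_{p+j}$; accordingly $H_t\otimes H_s\otimes H_{m-t}\otimes H_{n-s}$ (with $t+s=k$) is a subalgebra of $H_k\otimes H_{m+n-k}$. $\mathrm{mod}(A)$ is the category of left $A$-modules. For a subalgebra $B\subseteq A$, $N\uparrow^A_B:=A\otimes_B N$ for a left $B$-module $N$, and $L\downarrow^A_B$ is the left $A$-module $L$ regarded as a $B$-module. On an arbitrary (not necessarily factorized) module, $\mathtt{T}_{t,s}$ is the functor that keeps the underlying space and pulls the action back along the algebra isomorphism $H_t \otimes H_s \otimes H_{m-t} \otimes H_{n-s}\to H_t \otimes H_{m-t} \otimes H_s \otimes H_{n-s}$ that exchanges the two middle tensor factors. *)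

(* Defs.v *)
From HB Require Import structures.
From mathcomp Require Import all_boot all_order all_algebra.
From mathcomp Require Import finmap boolp classical_sets reals complex.
From mathcomp Require Import zify.
From mathcomp.multinomials Require Import monalg.
Set Implicit Arguments.
Unset Strict Implicit.
Unset Printing Implicit Defensive.

Import GRing.Theory.
Local Open Scope ring_scope.

Section FreeAbelian.
Variables (T : choiceType) (G : zmodType) (f : T -> G).
Implicit Types g : {malg int[T]}.

Definition free_lift g : G := \sum_(k <- msupp g) f k *~ g@_k.

Lemma free_liftEw (d : {fset T}) g : (msupp g `<=` d)%fset ->
  free_lift g = \sum_(k <- d) f k *~ g@_k.
Proof.
move=> le; rewrite [LHS](big_fset_incl _ le) => //= x xd /mcoeff_outdom ->.
by rewrite mulr0z.
Qed.

Lemma free_lift_is_zmod_morphism : zmod_morphism free_lift.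
Proof.
move=> g1 g2; pose d := (msupp g1 `|` msupp g2)%fset.
rewrite (@free_liftEw d g1) ?fsubsetUl // (@free_liftEw d g2) ?fsubsetUr //.
rewrite (@free_liftEw d).
  by rewrite -sumrB; apply: eq_bigr => k _; rewrite mcoeffB mulrzBr.
exact: msuppB_le.
Qed.

HB.instance Definition _ :=
  GRing.isZmodMorphism.Build {malg int[T]} G free_lift
    free_lift_is_zmod_morphism.

Lemma free_liftU k : free_lift << k >> = f k.
Proof.
rewrite (@free_liftEw [fset k]%fset) ?msuppU_le //.
by rewrite big_seq_fset1 mcoeffUU.
Qed.

End FreeAbelian.

Lemma free_ind (T : choiceType) (P : {malg int[T]} -> Prop) :
  P 0 -> (forall x y, P x -> P y -> P (x - y)) -> (forall k, P << k >>) ->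
  forall g, P g.
Proof.
move=> P0 PB PU g.
have PN x : P x -> P (- x) by move=> Px; rewrite -[- x]sub0r; exact: PB.
have PD x y : P x -> P y -> P (x + y).
  by move=> Px Py; rewrite -[y]opprK; apply/PB/PN.
have PM x n : P x -> P (x *+ n).
  by move=> Px; elim: n => [|n IH]; rewrite ?mulr0n // mulrS; exact: PD.
rewrite [g]monalgE; elim/big_ind: _ => // k _.
case: (g@_k) => n.
  by rewrite -[Posz n]natz monalgUMn; exact: PM.
by rewrite NegzE -[Posz _]natz monalgUMNn; exact/PN/PM.
Qed.

(* X (x) Y, the free abelian group on X * Y modulo the biadditivity         *)
(* relations and r s x (x) y = x (x) l s y, for s : S.                      *)

Section BalancedTensor.
Variables (S : Type) (X Y : zmodType) (r : S -> X -> X) (l : S -> Y -> Y).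

Inductive bal_rel : {malg int[(X * Y)%type]} -> Prop :=
| bal_rel0 : bal_rel 0
| bal_relB u v of bal_rel u & bal_rel v : bal_rel (u - v)
| bal_rel_addl x x' y :
    bal_rel (<< (x + x', y) >> - (<< (x, y) >> + << (x', y) >>))
| bal_rel_addr x y y' :
    bal_rel (<< (x, y + y') >> - (<< (x, y) >> + << (x, y') >>))
| bal_rel_scale s x y : bal_rel (<< (r s x, y) >> - << (x, l s y) >>).

Definition bal_pred (u : {malg int[(X * Y)%type]}) : bool := `[< bal_rel u >].

Lemma bal_zmod_closed : zmod_closed bal_pred.
Proof.
split; first exact/asboolP/bal_rel0.
by move=> u v /asboolP ru /asboolP rv; exact/asboolP/bal_relB.
Qed.

HB.instance Definition _ := GRing.isZmodClosed.Build _ bal_pred bal_zmod_closed.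

Definition bal_sub : zmodClosed {malg int[(X * Y)%type]} :=
  GRing.ZmodClosed.clone _ bal_pred _.

Definition btensor : Type := Quotient.quot bal_sub.
HB.instance Definition _ := GRing.Zmodule.on btensor.

Definition bclass (u : {malg int[(X * Y)%type]}) : btensor :=
  (\pi_(Quotient.quot bal_sub) u)%qT.

Definition brepr (u : btensor) : {malg int[(X * Y)%type]} :=
  @repr _ (Quotient.quot bal_sub) u.

Lemma breprK : cancel brepr bclass.
Proof. exact: reprK. Qed.

Lemma bclass_is_zmod_morphism : zmod_morphism bclass.
Proof. exact: (raddfB (\pi_(Quotient.quot bal_sub))%qT). Qed.

HB.instance Definition _ :=
  GRing.isZmodMorphism.Build {malg int[(X * Y)%type]} btensor bclass
    bclass_is_zmod_morphism.

Lemma bclass_eq u v : bal_rel (u - v) -> bclass u = bclass v.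
Proof.
by move=> uv; apply/eqP; rewrite /bclass -Quotient.idealrBE; exact/asboolP.
Qed.

Lemma bclass_eq_rel u v : bclass u = bclass v -> bal_rel (u - v).
Proof.
move=> /eqP; rewrite /bclass -Quotient.idealrBE => h; exact/asboolP.
Qed.

(* btens and btensor_lift, like fgen, quot_mul and quot_scale below, are      *)
(* locked to keep unification from unfolding the quotient constructions.      *)
Fact btens_key : unit. Proof. by []. Qed.
Definition btens : X -> Y -> btensor :=
  locked_with btens_key (fun x y => bclass << (x, y) >>).

Lemma btensE x y : btens x y = bclass << (x, y) >>.
Proof. by rewrite /btens locked_withE. Qed.

Lemma btensDl y : {morph btens^~ y : x x' / x + x'}.
Proof.
move=> x x'; rewrite !btensE -raddfD; apply: bclass_eq; exact: bal_rel_addl.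
Qed.

Lemma btensDr x : {morph btens x : y y' / y + y'}.
Proof.
move=> y y'; rewrite !btensE -raddfD; apply: bclass_eq; exact: bal_rel_addr.
Qed.

Lemma btens_bal s x y : btens (r s x) y = btens x (l s y).
Proof. rewrite !btensE; apply: bclass_eq; exact: bal_rel_scale. Qed.

Lemma btensor_ind (P : btensor -> Prop) :
  P 0 -> (forall u v, P u -> P v -> P (u - v)) ->
  (forall x y, P (btens x y)) -> forall u, P u.
Proof.
move=> P0 PB PU u; rewrite -[u]breprK.
elim/free_ind: (brepr _) => [|x y|[x y]]; last by rewrite -btensE.
- by rewrite raddf0.
- by rewrite raddfB; exact: PB.
Qed.

Record balanced (G : zmodType) (f : X -> Y -> G) : Prop := Balanced {
  balancedDl : forall y, {morph f^~ y : x x' / x + x'};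
  balancedDr : forall x, {morph f x : y y' / y + y'};
  balancedS : forall s x y, f (r s x) y = f x (l s y)
}.

Section Lift.
Variables (G : zmodType) (f : X -> Y -> G).

Fact btensor_lift_key : unit. Proof. by []. Qed.
Definition btensor_lift : btensor -> G :=
  locked_with btensor_lift_key
    (fun u => free_lift (fun p => f p.1 p.2) (brepr u)).

Hypothesis fP : balanced f.

Lemma btensor_liftP u : bal_rel u -> free_lift (fun p => f p.1 p.2) u = 0.
Proof.
elim => [|{}u v _ u0 _ v0|x x' y|x y y'|s x y]; rewrite ?raddfB ?raddfD /=.
- exact: raddf0.
- by rewrite u0 v0 subr0.
- by rewrite !free_liftU /= (balancedDl fP) -opprD subrr.
- by rewrite !free_liftU /= (balancedDr fP) -opprD subrr.
- by rewrite !free_liftU /= (balancedS fP) subrr.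
Qed.

Lemma btensor_lift_class u :
  btensor_lift (bclass u) = free_lift (fun p => f p.1 p.2) u.
Proof.
apply/eqP; rewrite -subr_eq0 /btensor_lift locked_withE -raddfB; apply/eqP.
by apply/btensor_liftP/bclass_eq_rel; rewrite breprK.
Qed.

Lemma btensor_lift_is_zmod_morphism : zmod_morphism btensor_lift.
Proof.
move=> u v; rewrite -[u]breprK -[v]breprK -raddfB !btensor_lift_class.
exact: raddfB.
Qed.

Lemma btensor_liftD : {morph btensor_lift : u v / u + v}.
Proof.
pose h := GRing.isZmodMorphism.Build _ _ _ btensor_lift_is_zmod_morphism.
pose g : {additive btensor -> G} := HB.pack btensor_lift h.
exact: (raddfD g).
Qed.

Lemma btensor_lift0 : btensor_lift 0 = 0.
Proof. by rewrite -[0](subrr 0) btensor_lift_is_zmod_morphism subrr. Qed.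

Lemma btensor_liftE x y : btensor_lift (btens x y) = f x y.
Proof. by rewrite btensE btensor_lift_class free_liftU. Qed.

End Lift.

End BalancedTensor.

Section Modules.
Variables (A : nzRingType).

Definition lmod_iso (V W : lmodType A) : Prop :=
  exists f : {linear V -> W}, bijective f.

(* The index type is finite, so the direct sum is the product. *)
Section DirectSum.
Variables (I : finType) (V : I -> lmodType A).

Definition dirsum : Type := {dffun forall i : I, V i}.
HB.instance Definition _ := Choice.on dirsum.
Implicit Types u v w : dirsum.

Definition dirsum0 : dirsum := [ffun i => 0].
Definition dirsum_opp u : dirsum := [ffun i => - u i].
Definition dirsum_add u v : dirsum := [ffun i => u i + v i].
Definition dirsum_scale a u : dirsum := [ffun i => a *: u i].

Lemma dirsum_addA : associative dirsum_add.
Proof. by move=> u v w; apply/ffunP => i; rewrite !ffunE addrA. Qed.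

Lemma dirsum_addC : commutative dirsum_add.
Proof. by move=> u v; apply/ffunP => i; rewrite !ffunE addrC. Qed.

Lemma dirsum_add0 : left_id dirsum0 dirsum_add.
Proof. by move=> u; apply/ffunP => i; rewrite !ffunE add0r. Qed.

Lemma dirsum_addN : left_inverse dirsum0 dirsum_opp dirsum_add.
Proof. by move=> u; apply/ffunP => i; rewrite !ffunE addNr. Qed.

HB.instance Definition _ := GRing.isZmodule.Build dirsum
  dirsum_addA dirsum_addC dirsum_add0 dirsum_addN.

Lemma dirsum_scaleA a b u :
  dirsum_scale a (dirsum_scale b u) = dirsum_scale (a * b) u.
Proof. by apply/ffunP => i; rewrite !ffunE scalerA. Qed.

Lemma dirsum_scale1 : left_id 1 dirsum_scale.
Proof. by move=> u; apply/ffunP => i; rewrite !ffunE scale1r. Qed.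

Lemma dirsum_scaleDr : right_distributive dirsum_scale +%R.
Proof. by move=> a u v; apply/ffunP => i; rewrite !ffunE scalerDr. Qed.

Lemma dirsum_scaleDl u : {morph dirsum_scale^~ u : a b / a + b}.
Proof. by move=> a b; apply/ffunP => i; rewrite !ffunE scalerDl. Qed.

HB.instance Definition _ := GRing.Zmodule_isLmodule.Build A dirsum
  dirsum_scaleA dirsum_scale1 dirsum_scaleDr dirsum_scaleDl.

End DirectSum.
End Modules.

Section Restriction.
Variables (A B : nzRingType) (f : {rmorphism B -> A}).

(* The B-module on the underlying group of V where b acts as f b. *)
Definition resmod (V : lmodType A) : Type :=
  let _ := f in V.

Variable V : lmodType A.
HB.instance Definition _ := GRing.Zmodule.copy (resmod V) V.

Definition resmod_scale (b : B) (v : resmod V) : resmod V :=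
  f b *: (v : V).

Lemma resmod_scaleA a b v :
  resmod_scale a (resmod_scale b v) = resmod_scale (a * b) v.
Proof. by rewrite /resmod_scale rmorphM scalerA. Qed.

Lemma resmod_scale1 : left_id 1 resmod_scale.
Proof. by move=> v; rewrite /resmod_scale rmorph1 scale1r. Qed.

Lemma resmod_scaleDr : right_distributive resmod_scale +%R.
Proof. by move=> b u v; rewrite /resmod_scale scalerDr. Qed.

Lemma resmod_scaleDl v : {morph resmod_scale^~ v : a b / a + b}.
Proof. by move=> a b; rewrite /resmod_scale rmorphD scalerDl. Qed.

HB.instance Definition _ := GRing.Zmodule_isLmodule.Build B (resmod V)
  resmod_scaleA resmod_scale1 resmod_scaleDr resmod_scaleDl.

End Restriction.

Lemma zmod_morphism0 (U V : zmodType) (f : U -> V) : zmod_morphism f -> f 0 = 0.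
Proof. by move=> fB; rewrite -[0](subrr 0) fB subrr. Qed.

Section Induction.
Variables (A B : nzRingType) (f : {rmorphism B -> A}).

(* A (x)_B V, where b : B acts on the right of A by f b. *)
Definition indmod (V : lmodType B) : Type :=
  btensor (fun (b : B) (a : A) => a * f b) (fun (b : B) (v : V) => b *: v).

Variable V : lmodType B.
HB.instance Definition _ := GRing.Zmodule.on (indmod V).

Definition indtens (a : A) (v : V) : indmod V := btens _ _ a v.

Definition indmod_scale (a : A) (u : indmod V) : indmod V :=
  btensor_lift (fun a' v => indtens (a * a') v) u.

Lemma indmod_scale_balanced a : balanced
  (fun (b : B) (a : A) => a * f b) (fun (b : B) (v : V) => b *: v)
  (fun a' v => indtens (a * a') v).
Proof.
split=> [v x y|x u v|b x v]; rewrite /indtens.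
- by rewrite mulrDr btensDl.
- by rewrite btensDr.
- by rewrite mulrA btens_bal.
Qed.

Lemma indmod_scaleE a a' v :
  indmod_scale a (indtens a' v) = indtens (a * a') v.
Proof. exact: (btensor_liftE (indmod_scale_balanced a)). Qed.

Lemma indmod_scaleB a : zmod_morphism (indmod_scale a).
Proof. exact: (btensor_lift_is_zmod_morphism (indmod_scale_balanced a)). Qed.

Lemma indmod_scaleDr : right_distributive indmod_scale +%R.
Proof. by move=> a; exact: (btensor_liftD (indmod_scale_balanced a)). Qed.

Lemma indmod_scaleA a b u :
  indmod_scale a (indmod_scale b u) = indmod_scale (a * b) u.
Proof.
elim/btensor_ind: u => [|x y IHx IHy|x v].
- by rewrite !(zmod_morphism0 (@indmod_scaleB _)).
- by rewrite !indmod_scaleB IHx IHy.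
- by rewrite !indmod_scaleE mulrA.
Qed.

Lemma indmod_scale1 : left_id 1 indmod_scale.
Proof.
elim/btensor_ind => [|x y IHx IHy|x v].
- exact: (zmod_morphism0 (@indmod_scaleB _)).
- by rewrite indmod_scaleB IHx IHy.
- by rewrite indmod_scaleE mul1r.
Qed.

Lemma indmod_scaleDl u : {morph indmod_scale^~ u : a b / a + b}.
Proof.
move=> a b; elim/btensor_ind: u => [|x y IHx IHy|x v].
- by rewrite !(zmod_morphism0 (@indmod_scaleB _)) addr0.
- by rewrite !indmod_scaleB IHx IHy opprD addrACA.
- by rewrite !indmod_scaleE mulrDl [LHS]btensDl.
Qed.

HB.instance Definition _ := GRing.Zmodule_isLmodule.Build A (indmod V)
  indmod_scaleA indmod_scale1 indmod_scaleDr indmod_scaleDl.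

End Induction.

Section TensorProduct.
Variable K : fieldType.
Implicit Types V W : lmodType K.

Definition tensor V W : Type :=
  btensor (fun (c : K) (v : V) => c *: v) (fun (c : K) (w : W) => c *: w).

HB.instance Definition _ V W := GRing.Zmodule.on (tensor V W).

Definition tens V W (v : V) (w : W) : tensor V W := btens _ _ v w.

Lemma tensDl V W (w : W) : {morph (@tens V W)^~ w : v v' / v + v'}.
Proof. exact: btensDl. Qed.

Lemma tensDr V W (v : V) : {morph @tens V W v : w w' / w + w'}.
Proof. exact: btensDr. Qed.

Lemma tens_bal V W c (v : V) (w : W) : tens (c *: v) w = tens v (c *: w).
Proof. exact: btens_bal. Qed.

Definition bilinear_map V W (G : zmodType) (f : V -> W -> G) :=
  balanced (fun (c : K) (v : V) => c *: v) (fun (c : K) (w : W) => c *: w) f.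

Section Scale.
Variables V W : lmodType K.

Definition tensor_scale (c : K) (u : tensor V W) : tensor V W :=
  btensor_lift (fun v w => tens (c *: v) w) u.

Lemma tensor_scale_balanced c :
  bilinear_map (fun v w => tens (c *: v) w : tensor V W).
Proof.
split=> [v x y|x u v|b x v].
- by rewrite scalerDr tensDl.
- by rewrite tensDr.
- by rewrite scalerA mulrC -scalerA tens_bal.
Qed.

Lemma tensor_scaleE c v w : tensor_scale c (tens v w) = tens (c *: v) w.
Proof. exact: (btensor_liftE (tensor_scale_balanced c)). Qed.

Lemma tensor_scaleB c : zmod_morphism (tensor_scale c).
Proof. exact: (btensor_lift_is_zmod_morphism (tensor_scale_balanced c)). Qed.

Lemma tensor_scaleDr : right_distributive tensor_scale +%R.
Proof. by move=> c; exact: (btensor_liftD (tensor_scale_balanced c)). Qed.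

Lemma tensor_scaleA a b u :
  tensor_scale a (tensor_scale b u) = tensor_scale (a * b) u.
Proof.
elim/btensor_ind: u => [|x y IHx IHy|x v].
- by rewrite !(zmod_morphism0 (@tensor_scaleB _)).
- by rewrite !tensor_scaleB IHx IHy.
- by rewrite !tensor_scaleE scalerA.
Qed.

Lemma tensor_scale1 : left_id 1 tensor_scale.
Proof.
elim/btensor_ind => [|x y IHx IHy|x v].
- exact: (zmod_morphism0 (@tensor_scaleB _)).
- by rewrite tensor_scaleB IHx IHy.
- by rewrite tensor_scaleE scale1r.
Qed.

Lemma tensor_scaleDl u : {morph tensor_scale^~ u : a b / a + b}.
Proof.
move=> a b; elim/btensor_ind: u => [|x y IHx IHy|x v].
- by rewrite !(zmod_morphism0 (@tensor_scaleB _)) addr0.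
- by rewrite !tensor_scaleB IHx IHy opprD addrACA.
- by rewrite !tensor_scaleE scalerDl [LHS]tensDl.
Qed.

HB.instance Definition _ := GRing.Zmodule_isLmodule.Build K (tensor V W)
  tensor_scaleA tensor_scale1 tensor_scaleDr tensor_scaleDl.

Lemma tensZl c v w : tens (c *: v) w = c *: (tens v w : tensor V W).
Proof. by rewrite -[RHS]/(tensor_scale _ _) tensor_scaleE. Qed.

Lemma tensZr c v w : tens v (c *: w) = c *: (tens v w : tensor V W).
Proof. by rewrite -tens_bal tensZl. Qed.

Lemma tensor_ind (P : tensor V W -> Prop) :
  P 0 -> (forall u v, P u -> P v -> P (u - v)) ->
  (forall v w, P (tens v w)) -> forall u, P u.
Proof. exact: btensor_ind. Qed.

End Scale.

Section Lift.
Variables (V W : lmodType K) (G : zmodType) (f : V -> W -> G).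

Definition tensor_lift (u : tensor V W) : G := btensor_lift f u.

Hypothesis fP : bilinear_map f.

Lemma tensor_liftE v w : tensor_lift (tens v w) = f v w.
Proof. exact: (btensor_liftE fP). Qed.

Lemma tensor_lift_is_zmod_morphism : zmod_morphism tensor_lift.
Proof. exact: (btensor_lift_is_zmod_morphism fP). Qed.

Lemma tensor_liftD : {morph tensor_lift : u v / u + v}.
Proof. exact: (btensor_liftD fP). Qed.

Lemma tensor_lift0 : tensor_lift 0 = 0.
Proof. exact: (btensor_lift0 fP). Qed.

End Lift.

Lemma tensor_liftZ V W (U : lmodType K) (f : V -> W -> U) :
  bilinear_map f -> (forall c v w, f (c *: v) w = c *: f v w) ->
  scalable (tensor_lift f).
Proof.
move=> fP fZ c; elim/tensor_ind => [|u v IHu IHv|v w].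
- by rewrite scaler0 (tensor_lift0 fP) scaler0.
- by rewrite scalerBr !(tensor_lift_is_zmod_morphism fP) IHu IHv scalerBr.
- by rewrite -tensZl !tensor_liftE.
Qed.

(* The pairing (v1 (x) v2, w1 (x) w2) |-> p v1 w1 (x) q v2 w2. *)
Section Map2.
Variables (V1 V2 W1 W2 U1 U2 : lmodType K).
Variables (p : V1 -> W1 -> U1) (q : V2 -> W2 -> U2).

Record bilin (V W U : lmodType K) (f : V -> W -> U) : Prop := Bilin {
  bilinDl : forall w, {morph f^~ w : v v' / v + v'};
  bilinDr : forall v, {morph f v : w w' / w + w'};
  bilinZl : forall c v w, f (c *: v) w = c *: f v w;
  bilinZr : forall c v w, f v (c *: w) = c *: f v w
}.

Definition tensor_map2 (s : tensor V1 V2) (t : tensor W1 W2) : tensor U1 U2 :=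
  tensor_lift
    (fun v1 v2 => tensor_lift (fun w1 w2 => tens (p v1 w1) (q v2 w2)) t) s.

Hypotheses (pP : bilin p) (qP : bilin q).

Lemma tensor_map2_inner v1 v2 :
  bilinear_map (fun w1 w2 => tens (p v1 w1) (q v2 w2)).
Proof.
split=> [w x y|w x y|c w w'].
- by rewrite (bilinDr pP) tensDl.
- by rewrite (bilinDr qP) tensDr.
- by rewrite (bilinZr pP) (bilinZr qP) tens_bal.
Qed.

Lemma tensor_map2_outer t : bilinear_map
  (fun v1 v2 => tensor_lift (fun w1 w2 => tens (p v1 w1) (q v2 w2)) t).
Proof.
have iB v1 v2 := tensor_lift_is_zmod_morphism (tensor_map2_inner v1 v2).
have i0 v1 v2 := tensor_lift0 (tensor_map2_inner v1 v2).
have E v1 v2 w1 w2 := tensor_liftE (tensor_map2_inner v1 v2) w1 w2.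
split=> [v x y|v x y|c x y]; elim/tensor_ind: t => [|s t IHs IHt|w w'].
- by rewrite !i0 addr0.
- by rewrite !iB IHs IHt opprD addrACA.
- by rewrite !E (bilinDl pP) tensDl.
- by rewrite !i0 addr0.
- by rewrite !iB IHs IHt opprD addrACA.
- by rewrite !E (bilinDl qP) tensDr.
- by rewrite !i0.
- by rewrite !iB IHs IHt.
- by rewrite !E (bilinZl pP) (bilinZl qP) tens_bal.
Qed.

Lemma tensor_map2E v1 v2 w1 w2 :
  tensor_map2 (tens v1 v2) (tens w1 w2) = tens (p v1 w1) (q v2 w2).
Proof.
rewrite /tensor_map2 (tensor_liftE (tensor_map2_outer _)).
by rewrite (tensor_liftE (tensor_map2_inner _ _)).
Qed.

Lemma tensor_map2Bl t : zmod_morphism (tensor_map2^~ t).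
Proof. exact: (tensor_lift_is_zmod_morphism (tensor_map2_outer t)). Qed.

Lemma tensor_map2Dl t : {morph tensor_map2^~ t : s s' / s + s'}.
Proof. exact: (tensor_liftD (tensor_map2_outer t)). Qed.

Lemma tensor_map2Br s : zmod_morphism (tensor_map2 s).
Proof.
have iB v1 v2 := tensor_lift_is_zmod_morphism (tensor_map2_inner v1 v2).
move=> t t'; elim/tensor_ind: s => [|x y IHx IHy|v w].
- by rewrite !(zmod_morphism0 (tensor_map2Bl _)) subr0.
- by rewrite !tensor_map2Bl IHx IHy !opprD addrACA.
- by rewrite /tensor_map2 !(tensor_liftE (tensor_map2_outer _)) iB.
Qed.

Lemma tensor_map2Dr s : {morph tensor_map2 s : t t' / t + t'}.
Proof.
move=> t t'; rewrite -{1}[t']opprK tensor_map2Br -[- t']sub0r tensor_map2Br.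
rewrite opprB; congr (_ + _).
by rewrite (zmod_morphism0 (tensor_map2Br s)) subr0.
Qed.

Lemma tensor_map2Zl c s t : tensor_map2 (c *: s) t = c *: tensor_map2 s t.
Proof.
apply: (tensor_liftZ (tensor_map2_outer t)) => {}c x y.
have iB v1 v2 := tensor_lift_is_zmod_morphism (tensor_map2_inner v1 v2).
elim/tensor_ind: t => [|t t' IHt IHt'|w w'].
- by rewrite !(zmod_morphism0 (iB _ _)) scaler0.
- by rewrite !iB IHt IHt' scalerBr.
- by rewrite !(tensor_liftE (tensor_map2_inner _ _)) (bilinZl pP) tensZl.
Qed.

Lemma tensor_map2Zr c s t : tensor_map2 s (c *: t) = c *: tensor_map2 s t.
Proof.
elim/tensor_ind: s => [|s s' IHs IHs'|v w].
- by rewrite !(zmod_morphism0 (tensor_map2Bl _)) scaler0.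
- by rewrite !tensor_map2Bl IHs IHs' scalerBr.
- rewrite /tensor_map2 !(tensor_liftE (tensor_map2_outer _)).
  apply: (tensor_liftZ (tensor_map2_inner _ _)) => {}c x y.
  by rewrite (bilinZr pP) tensZl.
Qed.

End Map2.

(* A linear form taking the value 1 at a given nonzero vector. *)
Lemma exists_linear_form V (v : V) : v != 0 ->
  exists phi : V -> K, [/\ {morph phi : x y / x + y},
    forall c x, phi (c *: x) = c * phi x & phi v = 1].
Proof.
move=> v0.
pose P (X : set V) :=
  (forall c x y, X x -> X y -> X (c *: x + y)) /\ ~ X v.
have [X [[XD Xv] Xmax]] : exists X, P X /\ forall Y, (X `<` Y)%classic -> ~ P Y.
  apply: Zorn_bigcup => F FP Ftot; split; last first.
    by move=> [Y FY Yv]; case: (FP _ FY) => _; exact.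
  move=> c x y [Y FY Yx] [Z FZ Zy].
  case: (Ftot _ _ FY FZ) => sub.
    by exists Z => //; apply: (FP _ FZ).1 => //; exact: sub.
  by exists Y => //; apply: (FP _ FY).1 => //; exact: sub.
have X0 : X 0.
  apply: contrapT => nX0.
  have nX x : ~ X x.
    by move=> Xx; apply: nX0; rewrite -(addNr x) -scaleN1r; exact: XD.
  apply: (Xmax [set 0]%classic).
    split; first by move=> x /nX.
    by move/(_ 0 erefl)/nX.
  split; last by move/eqP; rewrite (negbTE v0).
  by move=> c x y -> ->; rewrite scaler0 addr0.
have XZ c x : X x -> X (c *: x) by move=> Xx; rewrite -[_ *: _]addr0; exact: XD.
have XB x y : X x -> X y -> X (x - y).
  by move=> Xx Xy; rewrite addrC -scaleN1r; exact: XD.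
have ex x : exists c, X (x - c *: v).
  have [Xx|nXx] := pselect (X x); first by exists 0; rewrite scale0r subr0.
  pose Y : set V := [set y | exists c z, X z /\ y = c *: x + z]%classic.
  have : ~ P Y.
    apply: Xmax; split.
      by move=> y Xy; exists 0, y; rewrite scale0r add0r.
    by move/(_ x) => h; apply: nXx; apply: h; exists 1, 0; rewrite scale1r addr0.
  move=> nPY; have [c [z [Xz vE]]] : Y v.
    apply: contrapT => nYv; apply: nPY; split=> // c y y'.
    move=> [d [z [Xz ->]]] [d' [z' [Xz' ->]]].
    exists (c * d + d'), (c *: z + z'); split; first exact: XD.
    by rewrite scalerDr scalerA scalerDl addrACA.
  have c0 : c != 0.
    by apply/eqP => c0; apply: Xv; rewrite vE c0 scale0r add0r.
  exists c^-1; rewrite vE scalerDr scalerA mulVf // scale1r opprD addrA subrr.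
  by rewrite add0r -scalerN; apply/XZ; rewrite -scaleN1r; exact: XZ.
have uniq x c d : X (x - c *: v) -> X (x - d *: v) -> c = d.
  move=> Xc Xd; apply/eqP; rewrite -subr_eq0; apply/negP => /negP cd.
  apply: Xv; rewrite -[v]scale1r -(mulVf cd) -scalerA; apply: XZ.
  rewrite scalerBl; have := XB _ _ Xd Xc.
  by rewrite opprB addrC addrA addrNK.
pose phi x := sval (cid (ex x)).
have phiP x : X (x - phi x *: v) by rewrite /phi; case: cid.
exists phi; split=> [x y|c x|].
- apply: (uniq (x + y)) => //; rewrite scalerDl opprD addrACA.
  by rewrite -[X in X + _]scale1r; exact: XD.
- apply: (uniq (c *: x)) => //; rewrite -scalerA -scalerBr; exact: XZ.
- by apply: (uniq v) => //; rewrite scale1r subrr.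
Qed.

Lemma tens_neq0 V W (v : V) (w : W) : v != 0 -> w != 0 -> tens v w != 0.
Proof.
move=> /exists_linear_form[phi [phiD phiZ phi1]].
move=> /exists_linear_form[psi [psiD psiZ psi1]].
have fP : bilinear_map (fun v w => phi v * psi w).
  split=> [y x x'|x y y'|c x y].
  - by rewrite phiD mulrDl.
  - by rewrite psiD mulrDr.
  - by rewrite phiZ psiZ mulrCA mulrA.
apply/eqP => /(congr1 (tensor_lift (fun v w => phi v * psi w))).
rewrite tensor_liftE // tensor_lift0 // phi1 psi1 mulr1 => /eqP.
by rewrite oner_eq0.
Qed.

End TensorProduct.

Section TensorAlgebra.
Variables (K : fieldType) (A B : algType K).

Definition talg : Type := tensor A B.
HB.instance Definition _ := GRing.Lmodule.on talg.
Implicit Types s t u : talg.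

Definition atens (a : A) (b : B) : talg := tens a b.

Definition talg_mul s t : talg := tensor_map2 *%R *%R s t.

Lemma mul_bilin (C : algType K) : bilin (fun x y : C => x * y).
Proof.
split=> [z x y|z x y|c x y|c x y].
- exact: mulrDl.
- exact: mulrDr.
- by rewrite scalerAl.
- by rewrite scalerAr.
Qed.

Lemma talg_mulE a a' b b' :
  talg_mul (atens a b) (atens a' b') = atens (a * a') (b * b').
Proof. exact: (tensor_map2E (mul_bilin A) (mul_bilin B)). Qed.

Lemma talg_mulBl t : zmod_morphism (talg_mul^~ t).
Proof. exact: (tensor_map2Bl (mul_bilin A) (mul_bilin B)). Qed.

Lemma talg_mulBr t : zmod_morphism (talg_mul t).
Proof. exact: (tensor_map2Br (mul_bilin A) (mul_bilin B)). Qed.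

Lemma talg_mulDl : left_distributive talg_mul +%R.
Proof. by move=> s t u; exact: (tensor_map2Dl (mul_bilin A) (mul_bilin B)). Qed.

Lemma talg_mulDr : right_distributive talg_mul +%R.
Proof. by move=> s t u; exact: (tensor_map2Dr (mul_bilin A) (mul_bilin B)). Qed.

Lemma talg_ind (P : talg -> Prop) :
  P 0 -> (forall s t, P s -> P t -> P (s - t)) ->
  (forall a b, P (atens a b)) -> forall t, P t.
Proof. exact: tensor_ind. Qed.

Lemma talg_mul0l t : talg_mul 0 t = 0.
Proof. exact: (zmod_morphism0 (talg_mulBl t)). Qed.

Lemma talg_mul0r t : talg_mul t 0 = 0.
Proof. exact: (zmod_morphism0 (talg_mulBr t)). Qed.

Lemma talg_mulA : associative talg_mul.
Proof.
move=> s t u; elim/talg_ind: s => [|s s' IH IH'|a b].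
- by rewrite !talg_mul0l.
- by rewrite !talg_mulBl IH IH'.
elim/talg_ind: t => [|t t' IH IH'|a' b'].
- by rewrite talg_mul0r !talg_mul0l talg_mul0r.
- by rewrite talg_mulBl !talg_mulBr talg_mulBl IH IH'.
elim/talg_ind: u => [|u u' IH IH'|a'' b''].
- by rewrite !talg_mul0r.
- by rewrite !talg_mulBr IH IH'.
- by rewrite !talg_mulE !mulrA.
Qed.

Lemma talg_mul1l : left_id (atens 1 1) talg_mul.
Proof.
elim/talg_ind => [|s s' IH IH'|a b].
- exact: talg_mul0r.
- by rewrite talg_mulBr IH IH'.
- by rewrite talg_mulE !mul1r.
Qed.

Lemma talg_mul1r : right_id (atens 1 1) talg_mul.
Proof.
elim/talg_ind => [|s s' IH IH'|a b].
- exact: talg_mul0l.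
- by rewrite talg_mulBl IH IH'.
- by rewrite talg_mulE !mulr1.
Qed.

Lemma talg_1neq0 : atens 1 1 != 0.
Proof. exact: (tens_neq0 (oner_neq0 A) (oner_neq0 B)). Qed.

HB.instance Definition _ := GRing.Zmodule_isNzRing.Build talg
  talg_mulA talg_mul1l talg_mul1r talg_mulDl talg_mulDr talg_1neq0.

Lemma talg_scaleAl (c : K) s t : c *: (s * t) = (c *: s) * t.
Proof. exact: esym (tensor_map2Zl (mul_bilin A) (mul_bilin B) _ _ _). Qed.

HB.instance Definition _ :=
  GRing.Lmodule_isLalgebra.Build K talg talg_scaleAl.

Lemma talg_scaleAr (c : K) s t : c *: (s * t) = s * (c *: t).
Proof. exact: esym (tensor_map2Zr (mul_bilin A) (mul_bilin B) _ _ _). Qed.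

HB.instance Definition _ :=
  GRing.Lalgebra_isAlgebra.Build K talg talg_scaleAr.

Lemma atensM a a' b b' : atens a b * atens a' b' = atens (a * a') (b * b').
Proof. exact: talg_mulE. Qed.

Lemma atens1 : atens 1 1 = 1.
Proof. by []. Qed.

Lemma atensDl b : {morph atens^~ b : a a' / a + a'}.
Proof. exact: tensDl. Qed.

Lemma atensDr a : {morph atens a : b b' / b + b'}.
Proof. exact: tensDr. Qed.

Lemma atensZl c a b : atens (c *: a) b = c *: atens a b.
Proof. exact: tensZl. Qed.

Lemma atensZr c a b : atens a (c *: b) = c *: atens a b.
Proof. exact: tensZr. Qed.

Lemma atens_eta a b : atens a b = atens a 1 * atens 1 b.
Proof. by rewrite atensM mul1r mulr1. Qed.

End TensorAlgebra.

Notation "A \ot B" := (talg A B) (at level 40, left associativity) : type_scope.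

Section TensorAlgebraMorphisms.
Variable K : fieldType.
Implicit Types A B C D : algType K.

Section Inclusions.
Variables A B : algType K.

Definition tinl (a : A) : A \ot B := atens a 1.

Lemma tinl_is_zmod_morphism : zmod_morphism tinl.
Proof.
move=> x y; apply/eqP; rewrite eq_sym subr_eq /tinl -atensDl.
by rewrite addrNK.
Qed.

Lemma tinl_is_monoid_morphism : monoid_morphism tinl.
Proof. by split=> // x y; rewrite /tinl atensM mulr1. Qed.

Lemma tinl_is_scalable : scalable tinl.
Proof. by move=> c x; rewrite /tinl atensZl. Qed.

HB.instance Definition _ := GRing.isZmodMorphism.Build A (A \ot B) tinl
  tinl_is_zmod_morphism.
HB.instance Definition _ := GRing.isMonoidMorphism.Build A (A \ot B) tinl
  tinl_is_monoid_morphism.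
HB.instance Definition _ := GRing.isScalable.Build K A (A \ot B) *:%R tinl
  tinl_is_scalable.

Definition tinr (b : B) : A \ot B := atens 1 b.

Lemma tinr_is_zmod_morphism : zmod_morphism tinr.
Proof.
move=> x y; apply/eqP; rewrite eq_sym subr_eq /tinr -atensDr.
by rewrite addrNK.
Qed.

Lemma tinr_is_monoid_morphism : monoid_morphism tinr.
Proof. by split=> // x y; rewrite /tinr atensM mulr1. Qed.

Lemma tinr_is_scalable : scalable tinr.
Proof. by move=> c x; rewrite /tinr atensZr. Qed.

HB.instance Definition _ := GRing.isZmodMorphism.Build B (A \ot B) tinr
  tinr_is_zmod_morphism.
HB.instance Definition _ := GRing.isMonoidMorphism.Build B (A \ot B) tinr
  tinr_is_monoid_morphism.
HB.instance Definition _ := GRing.isScalable.Build K B (A \ot B) *:%R tinr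
  tinr_is_scalable.

Lemma tinlr_comm a b : GRing.comm (tinl a) (tinr b).
Proof.
by rewrite /GRing.comm (atensM a _ 1) (atensM 1 a b) !mul1r !mulr1.
Qed.

End Inclusions.

Section Lift.
Variables (A B C : algType K).
Variables (f : {lrmorphism A -> C}) (g : {lrmorphism B -> C}).
Hypothesis fg : forall a b, GRing.comm (f a) (g b).

Definition talg_lift_fun of (forall a b, GRing.comm (f a) (g b)) :=
  fun t : A \ot B => tensor_lift (fun a b => f a * g b) t : C.

Lemma talg_lift_bilin : bilinear_map (fun a b => f a * g b).
Proof.
split=> [b a a'|a b b'|c a b].
- by rewrite rmorphD mulrDl.
- by rewrite rmorphD mulrDr.
- by rewrite !linearZ -scalerAl -scalerAr.
Qed.

Local Notation h := (talg_lift_fun fg).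

Lemma talg_lift_funE a b : h (atens a b) = f a * g b.
Proof. exact: (tensor_liftE talg_lift_bilin). Qed.

Lemma talg_lift_is_zmod_morphism : zmod_morphism h.
Proof. exact: (tensor_lift_is_zmod_morphism talg_lift_bilin). Qed.

HB.instance Definition _ := GRing.isZmodMorphism.Build (A \ot B) C h
  talg_lift_is_zmod_morphism.

Lemma talg_lift_is_monoid_morphism : monoid_morphism h.
Proof.
split=> [|s t]; first by rewrite -atens1 talg_lift_funE !rmorph1 mulr1.
elim/talg_ind: s => [|s s' IH IH'|a b].
- by rewrite mul0r raddf0 mul0r.
- by rewrite mulrBl !raddfB /= IH IH' mulrBl.
elim/talg_ind: t => [|t t' IH IH'|a' b'].
- by rewrite mulr0 raddf0 mulr0.
- by rewrite mulrBr !raddfB /= IH IH' mulrBr.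
- rewrite atensM !talg_lift_funE !rmorphM -!mulrA; congr (_ * _).
  by rewrite !mulrA; congr (_ * _); exact: fg.
Qed.

HB.instance Definition _ := GRing.isMonoidMorphism.Build (A \ot B) C h
  talg_lift_is_monoid_morphism.

Lemma talg_lift_is_scalable : scalable h.
Proof.
apply: (tensor_liftZ talg_lift_bilin) => c a b.
by rewrite linearZ scalerAl.
Qed.

HB.instance Definition _ := GRing.isScalable.Build K (A \ot B) C *:%R h
  talg_lift_is_scalable.

Definition talg_lift : {lrmorphism A \ot B -> C} := h.

Lemma talg_liftE a b : talg_lift (atens a b) = f a * g b.
Proof. exact: talg_lift_funE. Qed.

End Lift.

Section Map.
Variables (A B A' B' : algType K).
Variables (f : {lrmorphism A -> A'}) (g : {lrmorphism B -> B'}).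

Lemma talg_map_comm a b :
  GRing.comm ((@tinl A' B' \o f) a) ((@tinr A' B' \o g) b).
Proof. exact: tinlr_comm. Qed.

Definition talg_map : {lrmorphism A \ot B -> A' \ot B'} :=
  talg_lift talg_map_comm.

Lemma talg_mapE a b : talg_map (atens a b) = atens (f a) (g b).
Proof. by rewrite talg_liftE -atens_eta. Qed.

End Map.

Section Swap.
Variables A B C D : algType K.

Lemma talg_swap_comm s t :
  GRing.comm (talg_map (@tinl A C) (@tinl B D) s)
             (talg_map (@tinr A C) (@tinr B D) t).
Proof.
rewrite /GRing.comm; elim/talg_ind: s => [|s s' IH IH'|a b].
- by rewrite raddf0 mul0r mulr0.
- by rewrite raddfB mulrBl mulrBr IH IH'.
elim/talg_ind: t => [|t t' IH IH'|c d].
- by rewrite raddf0 mul0r mulr0.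
- by rewrite raddfB mulrBl mulrBr IH IH'.
rewrite (talg_mapE (@tinl A C) (@tinl B D)) (talg_mapE (@tinr A C) (@tinr B D)).
rewrite (atensM (tinl C a)) (atensM (tinr A c)).
by rewrite (tinlr_comm a c) (tinlr_comm b d).
Qed.

(* (a (x) b) (x) (c (x) d) |-> (a (x) c) (x) (b (x) d) *)
Definition talg_swap :
    {lrmorphism (A \ot B) \ot (C \ot D) -> (A \ot C) \ot (B \ot D)} :=
  talg_lift talg_swap_comm.

Lemma talg_swapE a b c d :
  talg_swap (atens (atens a b) (atens c d)) = atens (atens a c) (atens b d).
Proof.
rewrite (talg_liftE talg_swap_comm).
rewrite (talg_mapE (@tinl A C) (@tinl B D)) (talg_mapE (@tinr A C) (@tinr B D)).
by rewrite (atensM (tinl C a)) -!atens_eta.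
Qed.

End Swap.

End TensorAlgebraMorphisms.

Section OuterTensor.
Variables (K : fieldType) (A B : algType K).
Variables (V : lmodType A) (W : lmodType B).

(* A-modules are vector spaces through the structure map c |-> c *: 1. *)
Definition scalars (C : algType K) (U : lmodType C) : Type :=
  resmod (GRing.RMorphism.clone _ _ (in_alg C) _) U.
HB.instance Definition _ (C : algType K) (U : lmodType C) :=
  GRing.Lmodule.on (scalars U).

Lemma scalarsE (C : algType K) (U : lmodType C) (c : K) (u : U) :
  c *: (u : scalars U) = c%:A *: u.
Proof. by []. Qed.

Definition otensor : Type := tensor (scalars V) (scalars W).
HB.instance Definition _ := GRing.Zmodule.on otensor.

Definition otens (v : V) (w : W) : otensor :=
  tens (v : scalars V) (w : scalars W).

Definition act (C : algType K) (U : lmodType C) (c : C) (u : scalars U) :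
  scalars U := c *: (u : U).

Lemma act_bilin (C : algType K) (U : lmodType C) : bilin (@act C U).
Proof.
split=> [u a b|a u v|c a u|c a u].
- exact: (@scalerDl _ U u a b).
- exact: (@scalerDr _ U a u v).
- by rewrite /act scalarsE scalerA mulr_algl.
- by rewrite /act !scalarsE !scalerA mulr_algl mulr_algr.
Qed.

Definition otensor_scale (t : A \ot B) (u : otensor) : otensor :=
  tensor_map2 (@act A V) (@act B W) t u.

Lemma otensor_scaleE a b v w :
  otensor_scale (atens a b) (otens v w) = otens (a *: v) (b *: w).
Proof. exact: (tensor_map2E (act_bilin V) (act_bilin W)). Qed.

Lemma otensor_scaleBl u : zmod_morphism (otensor_scale^~ u).
Proof. exact: (tensor_map2Bl (act_bilin V) (act_bilin W)). Qed.

Lemma otensor_scaleBr t : zmod_morphism (otensor_scale t).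
Proof. exact: (tensor_map2Br (act_bilin V) (act_bilin W)). Qed.

Lemma otensor_scaleDl u : {morph otensor_scale^~ u : s t / s + t}.
Proof. exact: (tensor_map2Dl (act_bilin V) (act_bilin W)). Qed.

Lemma otensor_scaleDr : right_distributive otensor_scale +%R.
Proof.
by move=> t u u'; exact: (tensor_map2Dr (act_bilin V) (act_bilin W)).
Qed.

Lemma otensor_ind (P : otensor -> Prop) :
  P 0 -> (forall u u', P u -> P u' -> P (u - u')) ->
  (forall v w, P (otens v w)) -> forall u, P u.
Proof. exact: tensor_ind. Qed.

Lemma otensor_scale0l u : otensor_scale 0 u = 0.
Proof. exact: (zmod_morphism0 (otensor_scaleBl u)). Qed.

Lemma otensor_scale0r t : otensor_scale t 0 = 0.
Proof. exact: (zmod_morphism0 (otensor_scaleBr t)). Qed.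

Lemma otensor_scaleA s t u :
  otensor_scale s (otensor_scale t u) = otensor_scale (s * t) u.
Proof.
elim/talg_ind: s => [|s s' IH IH'|a b].
- by rewrite mul0r !otensor_scale0l.
- by rewrite mulrBl !otensor_scaleBl IH IH'.
elim/talg_ind: t => [|t t' IH IH'|a' b'].
- by rewrite mulr0 otensor_scale0l otensor_scale0r.
- by rewrite mulrBr !otensor_scaleBl otensor_scaleBr IH IH'.
elim/otensor_ind: u => [|u u' IH IH'|v w].
- by rewrite !otensor_scale0r.
- by rewrite !otensor_scaleBr IH IH'.
- by rewrite atensM !otensor_scaleE !scalerA.
Qed.

Lemma otensor_scale1 : left_id 1 otensor_scale.
Proof.
elim/otensor_ind => [|u u' IH IH'|v w].
- exact: otensor_scale0r.
- by rewrite otensor_scaleBr IH IH'.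
- by rewrite -atens1 otensor_scaleE !scale1r.
Qed.

HB.instance Definition _ := GRing.Zmodule_isLmodule.Build (A \ot B) otensor
  otensor_scaleA otensor_scale1 otensor_scaleDr otensor_scaleDl.

Lemma otensZ a b v w : atens a b *: otens v w = otens (a *: v) (b *: w).
Proof. exact: otensor_scaleE. Qed.

End OuterTensor.

Section FreeAlgebra.
Variables (K : fieldType) (I : choiceType).

Definition free_alg : Type := {malg K[{fmonom I}]}.
HB.instance Definition _ := GRing.Lalgebra.on free_alg.

Fact fgen_key : unit. Proof. by []. Qed.
Definition fgen : I -> free_alg := locked_with fgen_key (fun i => << fmu i >>).

Lemma fgenE i : fgen i = << fmu i >>.
Proof. by rewrite /fgen locked_withE. Qed.

Lemma malgUM (k l : {fmonom I}) :
  (<< mmul k l >> : free_alg) = (<< k >> : free_alg) * (<< l >> : free_alg).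
Proof. by rewrite [RHS]fgmulUU mulr1. Qed.

Lemma malgUZ (c : K) (k : {fmonom I}) :
  << c *g k >> = c *: (<< k >> : free_alg).
Proof.
by apply/malgP => l; rewrite (mcoeffZ c << k >> l) !mcoeffU mulrnAr mulr1.
Qed.

Lemma free_alg_span (P : free_alg -> Prop) :
  P 0 -> (forall x y, P x -> P y -> P (x + y)) ->
  (forall c x, P x -> P (c *: x)) -> (forall k, P << k >>) -> forall x, P x.
Proof.
move=> P0 PD PZ PU x; rewrite [x]monalgE; elim/big_ind: _ => // k _.
by rewrite malgUZ; exact: PZ.
Qed.

Lemma free_alg_mulC (c : K) (x : free_alg) :
  (x : {malg K[{fmonom I}]}) * c%:MP = c *: x.
Proof.
rewrite [LHS]fgmulgU; apply: eq_bigr => k _.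
by rewrite mulrC mulm1.
Qed.

Lemma free_alg_scaleAr (c : K) (x y : free_alg) : c *: (x * y) = x * (c *: y).
Proof.
rewrite scalerAl -(free_alg_mulC c x) -(mul_malgC c y).
exact/esym/(@mulrA {malg K[{fmonom I}]}).
Qed.

HB.instance Definition _ :=
  GRing.Lalgebra_isAlgebra.Build K free_alg free_alg_scaleAr.

Lemma free_alg_ind (P : free_alg -> Prop) :
  P 0 -> (forall x y, P x -> P y -> P (x + y)) ->
  (forall c x, P x -> P (c *: x)) ->
  P 1 -> (forall i x, P x -> P (fgen i * x)) -> forall x, P x.
Proof.
move=> P0 PD PZ P1 PM; apply: free_alg_span => // -[s].
elim: s => [|i s IH]; first by rewrite -fmoneE.
have -> : FMonom (i :: s) = mmul (fmu i) (FMonom s).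
  by rewrite /mmul /= fmmulE fmuE.
by rewrite malgUM -fgenE; exact: PM.
Qed.

Section Lift.
Variables (C : algType K) (g : I -> C).

Definition fword (w : {fmonom I}) : C := \prod_(i <- w) g i.

Lemma fword_is_multiplicative : mmorphism fword.
Proof.
by split=> [v w|]; rewrite /fword; [rewrite fmM big_cat | rewrite fm1 big_nil].
Qed.

HB.instance Definition _ :=
  monalg.isMultiplicative.Build {fmonom I} C fword fword_is_multiplicative.

Definition free_alg_lift_fun (x : free_alg) : C := mmap (in_alg C) fword x.

Local Notation h := free_alg_lift_fun.

Lemma free_alg_lift_is_zmod_morphism : zmod_morphism h.
Proof. exact: raddfB. Qed.

Lemma free_alg_lift_is_monoid_morphism : monoid_morphism h.
Proof.
have [hM h1] : multiplicative h.
  by apply: commr_mmap_is_multiplicative => x m m'; exact: comm_alg.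
by split.
Qed.

Lemma free_alg_lift_is_scalable : scalable h.
Proof. by move=> c x; rewrite /h mmapZ /= mulr_algl. Qed.

HB.instance Definition _ := GRing.isZmodMorphism.Build free_alg C h
  free_alg_lift_is_zmod_morphism.
HB.instance Definition _ := GRing.isMonoidMorphism.Build free_alg C h
  free_alg_lift_is_monoid_morphism.
HB.instance Definition _ := GRing.isScalable.Build K free_alg C *:%R h
  free_alg_lift_is_scalable.

Definition free_alg_lift : {lrmorphism free_alg -> C} := h.

Lemma free_alg_lift_gen i : free_alg_lift (fgen i) = g i.
Proof.
rewrite fgenE -[LHS]/(mmap _ _ _) mmapU /= scale1r mul1r /fword fmU.
by rewrite big_seq1.
Qed.

End Lift.
End FreeAlgebra.

Section QuotientAlgebra.
Variables (K : fieldType) (A : algType K) (rel : A -> Prop).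

(* The two-sided ideal generated by rel. *)
Inductive ideal_of : A -> Prop :=
| ideal_of_rel x of rel x : ideal_of x
| ideal_of0 : ideal_of 0
| ideal_ofB x y of ideal_of x & ideal_of y : ideal_of (x - y)
| ideal_ofMl a x of ideal_of x : ideal_of (a * x)
| ideal_ofMr a x of ideal_of x : ideal_of (x * a).

Definition ideal_pred (x : A) : bool := `[< ideal_of x >].

Lemma ideal_zmod_closed : zmod_closed ideal_pred.
Proof.
split; first exact/asboolP/ideal_of0.
by move=> x y /asboolP rx /asboolP ry; exact/asboolP/ideal_ofB.
Qed.

HB.instance Definition _ := GRing.isZmodClosed.Build _ ideal_pred
  ideal_zmod_closed.

Definition ideal_sub : zmodClosed A := GRing.ZmodClosed.clone _ ideal_pred _.

Hypothesis proper : ~ ideal_of 1.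

Definition quot_alg of (~ ideal_of 1) : Type := Quotient.quot ideal_sub.

Local Notation Q := (quot_alg proper).

HB.instance Definition _ := GRing.Zmodule.on Q.

Fact qclass_key : unit. Proof. by []. Qed.
Definition qclass : A -> Q :=
  locked_with qclass_key (fun x => \pi_(Quotient.quot ideal_sub) x)%qT.

Fact qrepr_key : unit. Proof. by []. Qed.
Definition qrepr : Q -> A :=
  locked_with qrepr_key (@repr _ (Quotient.quot ideal_sub)).

Lemma qreprK : cancel qrepr qclass.
Proof. by move=> u; rewrite /qclass /qrepr !locked_withE; exact: reprK. Qed.

Lemma qclass_is_zmod_morphism : zmod_morphism qclass.
Proof.
rewrite /qclass locked_withE.
exact: (raddfB (\pi_(Quotient.quot ideal_sub))%qT).
Qed.

HB.instance Definition _ := GRing.isZmodMorphism.Build A Q qclass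
  qclass_is_zmod_morphism.

Lemma qclass_eq x y : ideal_of (x - y) -> qclass x = qclass y.
Proof.
move=> xy; apply/eqP; rewrite /qclass locked_withE -Quotient.idealrBE.
exact/asboolP.
Qed.

Lemma qclass_eq_ideal x y : qclass x = qclass y -> ideal_of (x - y).
Proof.
move=> /eqP; rewrite /qclass locked_withE -Quotient.idealrBE => h.
exact/asboolP.
Qed.

Lemma qrepr_class x : ideal_of (qrepr (qclass x) - x).
Proof. by apply: qclass_eq_ideal; rewrite qreprK. Qed.

Lemma qclass_ind (P : Q -> Prop) : (forall x, P (qclass x)) -> forall u, P u.
Proof. by move=> Px u; rewrite -[u]qreprK. Qed.

Definition quot_one : Q := qclass 1.

Fact quot_mul_key : unit. Proof. by []. Qed.
Definition quot_mul : Q -> Q -> Q :=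
  locked_with quot_mul_key (fun u v => qclass (qrepr u * qrepr v)).

Fact quot_scale_key : unit. Proof. by []. Qed.
Definition quot_scale : K -> Q -> Q :=
  locked_with quot_scale_key (fun c u => qclass (c *: qrepr u)).

Lemma quot_mulE x y : quot_mul (qclass x) (qclass y) = qclass (x * y).
Proof.
rewrite /quot_mul locked_withE; apply: qclass_eq; set x' := qrepr _; set y' := qrepr _.
rewrite -[x' * y'](subrK (x * y')) -mulrBl -addrA -mulrBr.
rewrite -[X in _ + X]opprK; apply: ideal_ofB.
  exact/ideal_ofMr/qrepr_class.
rewrite -[- _]sub0r; apply: ideal_ofB; first exact: ideal_of0.
exact/ideal_ofMl/qrepr_class.
Qed.

Lemma quot_scaleE c x : quot_scale c (qclass x) = qclass (c *: x).
Proof.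
rewrite /quot_scale locked_withE; apply: qclass_eq; rewrite -scalerBr -mulr_algl.
exact/ideal_ofMl/qrepr_class.
Qed.

Lemma quot_mulA : associative quot_mul.
Proof.
elim/qclass_ind=> x; elim/qclass_ind=> y; elim/qclass_ind=> z.
by rewrite !quot_mulE mulrA.
Qed.

Lemma quot_mul1l : left_id quot_one quot_mul.
Proof. by elim/qclass_ind=> x; rewrite quot_mulE mul1r. Qed.

Lemma quot_mul1r : right_id quot_one quot_mul.
Proof. by elim/qclass_ind=> x; rewrite quot_mulE mulr1. Qed.

Lemma quot_mulDl : left_distributive quot_mul +%R.
Proof.
elim/qclass_ind=> x; elim/qclass_ind=> y; elim/qclass_ind=> z.
by rewrite -raddfD !quot_mulE mulrDl raddfD.
Qed.

Lemma quot_mulDr : right_distributive quot_mul +%R.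
Proof.
elim/qclass_ind=> x; elim/qclass_ind=> y; elim/qclass_ind=> z.
by rewrite -raddfD !quot_mulE mulrDr raddfD.
Qed.

Lemma quot_1neq0 : quot_one != 0.
Proof.
apply/eqP; rewrite /quot_one -[0](raddf0 qclass) => /qclass_eq_ideal.
by rewrite subr0.
Qed.

HB.instance Definition _ := GRing.Zmodule_isNzRing.Build Q
  quot_mulA quot_mul1l quot_mul1r quot_mulDl quot_mulDr quot_1neq0.

Lemma quot_scaleA c d u :
  quot_scale c (quot_scale d u) = quot_scale (c * d) u.
Proof. by elim/qclass_ind: u => x; rewrite !quot_scaleE scalerA. Qed.

Lemma quot_scale1 : left_id 1 quot_scale.
Proof. by elim/qclass_ind=> x; rewrite quot_scaleE scale1r. Qed.

Lemma quot_scaleDr : right_distributive quot_scale +%R.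
Proof.
move=> c; elim/qclass_ind=> x; elim/qclass_ind=> y.
by rewrite -raddfD !quot_scaleE scalerDr raddfD.
Qed.

Lemma quot_scaleDl u : {morph quot_scale^~ u : c d / c + d}.
Proof.
by move=> c d; elim/qclass_ind: u => x; rewrite !quot_scaleE scalerDl raddfD.
Qed.

HB.instance Definition _ := GRing.Zmodule_isLmodule.Build K Q
  quot_scaleA quot_scale1 quot_scaleDr quot_scaleDl.

Lemma qclassM x y : qclass (x * y) = qclass x * qclass y.
Proof. by rewrite -[RHS]/(quot_mul _ _) quot_mulE. Qed.

Lemma qclassZ c x : qclass (c *: x) = c *: qclass x.
Proof. by rewrite -[RHS]/(quot_scale _ _) quot_scaleE. Qed.

Lemma quot_scaleAl (c : K) (u v : Q) : c *: (u * v) = (c *: u) * v.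
Proof.
elim/qclass_ind: u => x; elim/qclass_ind: v => y.
by rewrite -qclassM -!qclassZ -qclassM scalerAl.
Qed.

HB.instance Definition _ := GRing.Lmodule_isLalgebra.Build K Q quot_scaleAl.

Lemma quot_scaleAr (c : K) (u v : Q) : c *: (u * v) = u * (c *: v).
Proof.
elim/qclass_ind: u => x; elim/qclass_ind: v => y.
by rewrite -qclassM -!qclassZ -qclassM scalerAr.
Qed.

HB.instance Definition _ := GRing.Lalgebra_isAlgebra.Build K Q quot_scaleAr.

HB.instance Definition _ := GRing.isMonoidMorphism.Build A Q qclass
  (conj (erefl : qclass 1 = 1) qclassM).
HB.instance Definition _ := GRing.isScalable.Build K A Q *:%R qclass qclassZ.

Lemma qclass0 x : rel x -> qclass x = 0.
Proof.
move=> rx; rewrite -[0](raddf0 qclass); apply: qclass_eq.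
by rewrite subr0; exact: ideal_of_rel.
Qed.

Section Lift.
Variables (C : algType K) (f : {lrmorphism A -> C}).
Hypothesis f0 : forall x, rel x -> f x = 0.

Definition quot_lift_fun of (forall x, rel x -> f x = 0) :=
  fun u : Q => f (qrepr u).

Local Notation h := (quot_lift_fun f0).

Lemma quot_lift_ideal x : ideal_of x -> f x = 0.
Proof.
elim=> {x} [x /f0//||x y _ fx _ fy|a x _ fx|a x _ fx].
- exact: raddf0.
- by rewrite raddfB /= fx fy subr0.
- by rewrite rmorphM /= fx mulr0.
- by rewrite rmorphM /= fx mul0r.
Qed.

Lemma quot_lift_funE x : h (qclass x) = f x.
Proof.
apply/eqP; rewrite -subr_eq0 -raddfB; apply/eqP.
exact/quot_lift_ideal/qrepr_class.
Qed.

Lemma quot_lift_is_zmod_morphism : zmod_morphism h.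
Proof.
elim/qclass_ind=> x; elim/qclass_ind=> y.
by rewrite -raddfB !quot_lift_funE raddfB.
Qed.

Lemma quot_lift_is_monoid_morphism : monoid_morphism h.
Proof.
split; first by rewrite -[1]/(qclass 1) quot_lift_funE rmorph1.
elim/qclass_ind=> x; elim/qclass_ind=> y.
by rewrite -rmorphM !quot_lift_funE rmorphM.
Qed.

Lemma quot_lift_is_scalable : scalable h.
Proof.
by move=> c; elim/qclass_ind=> x; rewrite -qclassZ !quot_lift_funE linearZ.
Qed.

HB.instance Definition _ := GRing.isZmodMorphism.Build Q C h
  quot_lift_is_zmod_morphism.
HB.instance Definition _ := GRing.isMonoidMorphism.Build Q C h
  quot_lift_is_monoid_morphism.
HB.instance Definition _ := GRing.isScalable.Build K Q C *:%R h
  quot_lift_is_scalable.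

Definition quot_lift : {lrmorphism Q -> C} := h.

Lemma quot_liftE x : quot_lift (qclass x) = f x.
Proof. exact: quot_lift_funE. Qed.

End Lift.
End QuotientAlgebra.

Section Hecke.
Variables (K : closedFieldType) (a b : K).

Section Morphisms.
Variables (A C : algType K) (f : {lrmorphism A -> C}) (x y : A).

Lemma morph_quad :
  f (x ^+ 2 - (a *: x + b%:A)) = f x ^+ 2 - (a *: f x + b%:A).
Proof. by rewrite raddfB raddfD /= rmorphXn /= !linearZ /= rmorph1. Qed.

Lemma morph_braid :
  f (x * y * x - y * x * y) = f x * f y * f x - f y * f x * f y.
Proof. by rewrite raddfB /= !rmorphM. Qed.

Lemma morph_comm : f (x * y - y * x) = f x * f y - f y * f x.
Proof. by rewrite raddfB /= !rmorphM. Qed.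

End Morphisms.

Section Relations.
Variable n : nat.

(* The index i : 'I_n.-1 stands for the generator pi_(i+1). *)
Local Notation x i := (fgen K (i : 'I_n.-1)).

Inductive hecke_rel : free_alg K 'I_n.-1 -> Prop :=
| hecke_rel_quad (i : 'I_n.-1) : hecke_rel (x i ^+ 2 - (a *: x i + b%:A))
| hecke_rel_braid (i j : 'I_n.-1) of j = i.+1 :> nat :
    hecke_rel (x i * x j * x i - x j * x i * x j)
| hecke_rel_comm (i j : 'I_n.-1) of (2 <= `|i - j|)%N :
    hecke_rel (x i * x j - x j * x i).

(* Sending every generator to a root of X^2 - aX - b shows H_n <> 0. *)
Lemma hecke_proper : ~ ideal_of hecke_rel 1.
Proof.
have [z zE] := @solve_monicpoly K 2 (fun i => if i == 0%N then b else a) isT.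
rewrite !big_ord_recl big_ord0 /= expr0 mulr1 expr1 addr0 in zE.
pose f := free_alg_lift (fun _ : 'I_n.-1 => z : K^o).
have f0 y : hecke_rel y -> f y = 0.
  have fz i : f (fgen K i) = z by exact: free_alg_lift_gen.
  case=> {y} [i|i j _|i j _].
  - rewrite (morph_quad f) fz zE [X in X - _]addrC /GRing.scale /=.
    by rewrite mulr1 subrr.
  - by rewrite (morph_braid f) !fz subrr.
  - by rewrite (morph_comm f) !fz subrr.
move/(quot_lift_ideal f0)/eqP; rewrite rmorph1.
by rewrite oner_eq0.
Qed.

End Relations.

(* There are no generators for n <= 1: hecke 0 and hecke 1 are copies of K. *)
Definition hecke (n : nat) : Type := quot_alg (@hecke_proper n).
HB.instance Definition _ n := GRing.Algebra.on (hecke n).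

Definition hgen n (i : 'I_n.-1) : hecke n := qclass _ (fgen K i).

Lemma hgen_quad n (i : 'I_n.-1) : hgen i ^+ 2 = a *: hgen i + b%:A.
Proof.
apply/eqP; rewrite -subr_eq0; apply/eqP.
have := qclass0 (@hecke_proper n) (hecke_rel_quad i).
by rewrite (morph_quad (qclass (@hecke_proper n))).
Qed.

Lemma hgen_braid n (i j : 'I_n.-1) : j = i.+1 :> nat ->
  hgen i * hgen j * hgen i = hgen j * hgen i * hgen j.
Proof.
move=> ij; apply/eqP; rewrite -subr_eq0; apply/eqP.
have := qclass0 (@hecke_proper n) (hecke_rel_braid ij).
by rewrite (morph_braid (qclass (@hecke_proper n))).
Qed.

Lemma hgen_comm n (i j : 'I_n.-1) : (2 <= `|i - j|)%N ->
  hgen i * hgen j = hgen j * hgen i.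
Proof.
move=> ij; apply/eqP; rewrite -subr_eq0; apply/eqP.
have := qclass0 (@hecke_proper n) (hecke_rel_comm ij).
by rewrite (morph_comm (qclass (@hecke_proper n))).
Qed.

Lemma hecke_ind n (P : hecke n -> Prop) :
  P 0 -> (forall x y, P x -> P y -> P (x + y)) ->
  (forall c x, P x -> P (c *: x)) ->
  P 1 -> (forall i x, P x -> P (hgen i * x)) -> forall x, P x.
Proof.
move=> P0 PD PZ P1 PM; elim/qclass_ind; elim/free_alg_ind.
- by rewrite raddf0.
- by move=> x y Px Py; rewrite raddfD; exact: PD.
- by move=> c x Px; rewrite linearZ; exact: PZ.
- by rewrite rmorph1.
- by move=> i x Px; rewrite rmorphM; exact: PM.
Qed.

Lemma hecke_morph_comm n (C : algType K) (f : {lrmorphism hecke n -> C}) z :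
  (forall i, GRing.comm (f (hgen i)) z) -> forall x, GRing.comm (f x) z.
Proof.
move=> fz; have fM x y : f (x * y) = f x * f y := rmorphM f x y.
rewrite /GRing.comm; elim/hecke_ind => [|x y IHx IHy|c x IH||i x IH].
- by rewrite raddf0 mul0r mulr0.
- by rewrite raddfD mulrDl mulrDr IHx IHy.
- by rewrite linearZ -scalerAl -scalerAr IH.
- by rewrite rmorph1 mul1r mulr1.
- by rewrite fM -mulrA IH !mulrA fz.
Qed.

Section Shift.
Variables (p r d : nat) (le : (d + p <= r)%N).

Lemma hecke_shift_ord_subproof (i : 'I_p.-1) : (d + i < r.-1)%N.
Proof. by move: (ltn_ord i) le; lia. Qed.

Definition hecke_shift_ord (i : 'I_p.-1) : 'I_r.-1 :=
  Ordinal (hecke_shift_ord_subproof i).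

Definition hecke_shift_free : {lrmorphism free_alg K 'I_p.-1 -> hecke r} :=
  free_alg_lift (fun i => hgen (hecke_shift_ord i)).

Lemma hecke_shift_rel x : hecke_rel x -> hecke_shift_free x = 0.
Proof.
have fE i : hecke_shift_free (fgen K i) = hgen (hecke_shift_ord i).
  exact: free_alg_lift_gen.
case=> {x} [i|i j ij|i j ij].
- by rewrite (morph_quad hecke_shift_free) !fE hgen_quad subrr.
- rewrite (morph_braid hecke_shift_free) !fE hgen_braid ?subrr //=.
  by rewrite ij addnS.
- by rewrite (morph_comm hecke_shift_free) !fE hgen_comm ?subrr //= distnDl.
Qed.

(* The morphism H_p -> H_r sending pi_i to pi_(d+i). *)
Definition hecke_shift : {lrmorphism hecke p -> hecke r} :=
  quot_lift (@hecke_proper p) hecke_shift_rel.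

Lemma hecke_shiftE i : hecke_shift (hgen i) = hgen (hecke_shift_ord i).
Proof. by rewrite [LHS]quot_liftE [LHS]free_alg_lift_gen. Qed.

End Shift.

Section Embedding.
Variables (p q r : nat) (e : (p + q)%N = r).

Lemma hecke_emb_subproofl : (0 + p <= r)%N.
Proof. by rewrite -e leq_addr. Qed.

Lemma hecke_emb_subproofr : (p + q <= r)%N.
Proof. by rewrite e. Qed.

Lemma hecke_emb_comm (x : hecke p) (y : hecke q) :
  GRing.comm (hecke_shift hecke_emb_subproofl x)
             (hecke_shift hecke_emb_subproofr y).
Proof.
apply: hecke_morph_comm => i; apply/commr_sym; apply: hecke_morph_comm => j.
rewrite (hecke_shiftE hecke_emb_subproofl) (hecke_shiftE hecke_emb_subproofr).
by apply: hgen_comm; move: (ltn_ord i) (ltn_ord j) => /=; lia.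
Qed.

(* H_p \ot H_q -> H_(p+q), pi_i \ot 1 |-> pi_i and 1 \ot pi_j |-> pi_(p+j) *)
Definition hecke_emb : {lrmorphism hecke p \ot hecke q -> hecke r} :=
  talg_lift hecke_emb_comm.

Lemma hecke_emb_genl i : hecke_emb (atens (hgen i) 1) =
  hgen (hecke_shift_ord hecke_emb_subproofl i).
Proof. by rewrite [LHS]talg_liftE rmorph1 mulr1 hecke_shiftE. Qed.

Lemma hecke_emb_genr j : hecke_emb (atens 1 (hgen j)) =
  hgen (hecke_shift_ord hecke_emb_subproofr j).
Proof. by rewrite [LHS]talg_liftE rmorph1 mul1r hecke_shiftE. Qed.

End Embedding.

End Hecke.

Section Mackey.
Variables (K : closedFieldType) (a b : K).
Local Notation H := (hecke a b).

(* M [x] N, the induction of M (x) N from H_m \ot H_n to H_(m+n) *)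
Definition boxtimes (m n : nat) (M : lmodType (H m)) (N : lmodType (H n)) :
    lmodType (H (m + n)) :=
  indmod (hecke_emb a b (erefl (m + n)%N)) (otensor M N).

(* The functor T_(t,s), with p = m - t and q = n - s *)
Definition middle_swap (t s p q : nat)
    (V : lmodType ((H t \ot H p) \ot (H s \ot H q))) :
    lmodType ((H t \ot H s) \ot (H p \ot H q)) :=
  resmod (talg_swap (H t) (H s) (H p) (H q)) V.

Section Summand.
Variables (m n k t s : nat) (tm : (t <= m)%N) (sn : (s <= n)%N).
Variable (tsk : (t + s)%N = k).

Lemma mackey_subproof : (m - t + (n - s))%N = (m + n - k)%N.
Proof. by move: tm sn tsk; lia. Qed.

Definition mackey_summand (M : lmodType (H m)) (N : lmodType (H n)) :
    lmodType (H k \ot H (m + n - k)) :=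
  indmod (talg_map (hecke_emb a b tsk) (hecke_emb a b mackey_subproof))
    (middle_swap (otensor (resmod (hecke_emb a b (subnKC tm)) M)
                          (resmod (hecke_emb a b (subnKC sn)) N))).

End Summand.

(* The pairs (t, s) with t <= m, s <= n and t + s = k *)
Definition mackey_index (m n k : nat) : finType :=
  {ts : 'I_m.+1 * 'I_n.+1 | (ts.1 + ts.2 == k)%N}.

End Mackey.

Lemma mackey_bound (m n k : nat) :
  (1 <= k <= m + n - 1)%N -> (k + (m + n - k))%N = (m + n)%N.
Proof. lia. Qed.

(* Main.v *)
From HB Require Import structures.
From mathcomp Require Import all_boot all_order all_algebra.
From mathcomp Require Import boolp zify reals complex.
Require Import Defs.
Set Implicit Arguments.
Unset Strict Implicit.
Unset Printing Implicit Defensive.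
Import GRing.Theory.
Local Open Scope ring_scope.

(** Write T_w for the basis element of a Hecke algebra attached to a permutation
    w.  The formula holds because H_(m+n) is free as a right module over
    H_m (x) H_n, on the T_w of the minimal coset representatives w of
    S_m x S_n, and because this basis is compatible with cutting a word after
    its k-th letter.

    A minimal coset representative is encoded by the binary word d, with m zeros
    and n ones, into which it turns the sorted word 0^m 1^n; its basis element
    T_d is [shuffle_prod].  The product of the i-th generator with T_d depends
    on the letters of d at the places i and i + 1.  It is T_e, where e has these
    letters exchanged, if they are 01 ([shuffle_prod_up]); the generator passes
    through T_d and becomes a generator of H_m (x) H_n if they are equal
    ([shuffle_prod_flat]); and the case 10 follows from the case 01 and the
    quadratic relation.  Hence the T_d span ([hecke_span]).  The same rules
    define operators on the functions from words to H_m (x) H_n.  These satisfy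
    the Hecke relations ([word_op_quad], [word_op_braid], [word_op_comm]), so
    H_(m+n) acts on functions; applying an element to the function supported at
    the sorted word gives coordinates that are linear on the right
    ([coordMr]) and dual to the T_d ([coord_shuffle_prod]).

    Cut d = d1 d2 after k letters, and let t and s be the numbers of zeros and
    ones in d1.  Then T_d = (T_d1 (x) T_d2) T_c, where c = 0^t 1^s 0^p 1^q with
    p = m - t and q = n - s ([shuffle_prod_cat]).  The word c stands for a
    double coset, and T_c intertwines the two embeddings of
    H_t (x) H_s (x) H_p (x) H_q into H_(m+n), with the middle factors exchanged
    ([blocks_intertwine]).  So x (x) v |-> x T_c (x) v is a well-defined map
    from the summand of (t, s) to the induced module ([double_coset_map]).  It
    sends (T_d1 (x) T_d2) (x) v to T_d (x) v.  As d runs through all words, so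
    does the pair (d1, d2), and the sum of these maps is bijective because it
    carries spanning elements to a basis, each basis element being reached once
    ([basis_decomposition]). *)

(** * Products of generators attached to binary words *)

Notation zeros w := (count_mem false w).
Notation ones w := (count_mem true w).

Section ShuffleProducts.
Variable A : nzRingType.
Implicit Types (g : nat -> A) (u w d e : seq bool).

(** Indices run over all natural numbers.  This costs nothing, because 0
    satisfies both relations and can stand for the generators out of range. *)
Definition braided g := forall i, g i * g i.+1 * g i = g i.+1 * g i * g i.+1.
Definition distant g := forall i j, (i.+1 < j)%N -> g i * g j = g j * g i.

(** The product g_0 g_1 ... g_(z-1) carries a letter true leftwards over z
    letters false. *)
Definition cycle_prod g z := \prod_(i < z) g i.

(** For the generators g of a Hecke algebra this is the standard basis element
    of the minimal coset representative turning the sorted word 0^m 1^n into d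
    (0 is false, 1 is true).  Read as sorting d, the recursion deals with the
    tail first, with the generators shifted by one, and then brings the head
    letter to its place: a letter 1 has to cross exactly the letters 0 that
    follow it. *)
Fixpoint shuffle_prod g d : A :=
  if d is c :: d' then
    shuffle_prod (fun i => g i.+1) d' *
      (if c then cycle_prod g (zeros d') else 1)
  else 1.

Lemma cycle_prod0 g : cycle_prod g 0 = 1.
Proof. exact: big_ord0. Qed.

Lemma cycle_prod_recr g z : cycle_prod g z.+1 = cycle_prod g z * g z.
Proof. exact: big_ord_recr. Qed.

Lemma cycle_prod_recl g z : cycle_prod g z.+1 =
  g 0%N * cycle_prod (fun i => g i.+1) z.
Proof. exact: big_ord_recl. Qed.

Lemma braidedS g : braided g -> braided (fun i => g i.+1).
Proof. by move=> gB i; apply: (gB i.+1). Qed.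

Lemma distantS g : distant g -> distant (fun i => g i.+1).
Proof. by move=> gD i j ij; apply: (gD i.+1 j.+1). Qed.

Lemma cycle_prod_far g z j : distant g -> (z < j)%N -> g j * cycle_prod g z =
  cycle_prod g z * g j.
Proof.
move=> gD; elim: z => [|z IH] zj;
  first by rewrite /cycle_prod big_ord0 mul1r mulr1.
by rewrite cycle_prod_recr mulrA IH ?(ltnW zj) // -!mulrA (gD _ _ zj).
Qed.

(** The Coxeter relation s_(j+1) c = c s_j for the cycle c = s_0 ... s_(z-1);
    at the level of generators one braid relation is enough. *)
Lemma cycle_prod_slide g z j : braided g -> distant g -> (j.+1 < z)%N ->
  g j.+1 * cycle_prod g z = cycle_prod g z * g j.
Proof.
move=> gB gD; elim: z => // z IH; rewrite ltnS leq_eqVlt => /predU1P[<-|jz].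
  by rewrite !cycle_prod_recr !mulrA cycle_prod_far // -!mulrA; congr (_ * _);
    rewrite !mulrA gB.
by rewrite cycle_prod_recr mulrA IH // -!mulrA (gD _ _ jz).
Qed.

(** Two letters 1 brought over the same z letters 0: exchanging them before the
    move is the same as exchanging them after it.  With c the cycle of length
    z + 1, the left factor completes one of the two cycles to c, and the other
    cycle slides through c. *)
Lemma cycle_prod_double g z : braided g -> distant g ->
  g 0%N * (cycle_prod (fun i => g i.+1) z * cycle_prod g z) =
  cycle_prod (fun i => g i.+1) z * cycle_prod g z * g z.
Proof.
move=> gB gD; rewrite -mulrA -cycle_prod_recr mulrA -cycle_prod_recl.
(* Sliding the factors one at a time; the last of them needs j + 1 < z + 1. *)
have H k : (k <= z)%N ->
    cycle_prod (fun i => g i.+1) k * cycle_prod g z.+1 =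
      cycle_prod g z.+1 * cycle_prod g k.
  elim: k => [|k IH] kz; first by rewrite !cycle_prod0 mul1r mulr1.
  by rewrite !(cycle_prod_recr _ k) -mulrA cycle_prod_slide // mulrA IH
    ?(ltnW kz) // mulrA.
by rewrite H.
Qed.

(** A word of size r only involves the r - 1 generators that permute its
    places. *)
Lemma eq_shuffle_prod g g' d : (forall i, (i < (size d).-1)%N -> g i = g' i) ->
  shuffle_prod g d = shuffle_prod g' d.
Proof.
elim: d g g' => [|c d IH] g g' gg' //=.
congr (_ * _); first by apply: IH => i id; apply: gg' => /=; lia.
case: c gg' => //= gg'; apply: eq_bigr => i _; apply: gg'.
exact: leq_trans (ltn_ord i) (count_size _ _).
Qed.

Lemma shuffle_prod_comm g d x : (forall i, GRing.comm x (g i)) ->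
  GRing.comm x (shuffle_prod g d).
Proof.
elim: d g => [|c d IH] g xg /=; first exact: commr1.
apply: commrM; first exact: IH.
by case: c; [apply: commr_prod | exact: commr1].
Qed.

Lemma shuffle_prod_sorted g m n : shuffle_prod g (nseq m false ++ nseq n true) =
  1.
Proof.
elim: m g => [|m IH] g /=; last by rewrite IH mulr1.
elim: n g => [//|n IH] g /=; rewrite IH mul1r count_nseq mul0n.
by rewrite /cycle_prod big_ord0.
Qed.

(** In the recursion the letters in front of the exchanged pair contribute the
    same factors on both sides, so that only a word starting with the pair
    matters; there the two products differ by the first factor of one cycle,
    and this factor commutes with everything to its left. *)
Lemma shuffle_prod_up g u e : distant g ->
  g (size u) * shuffle_prod g (u ++ false :: true :: e) =
    shuffle_prod g (u ++ true :: false :: e).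
Proof.
elim: u g => [|c u IH] g gD /=; last first.
  rewrite mulrA [g _ * _](IH (fun i => g i.+1)) //; last exact: distantS.
  by congr (_ * (if c then cycle_prod g _ else 1));
    rewrite !count_cat /= addnCA.
rewrite !mulr1 add1n cycle_prod_recl !mulrA; congr (_ * _).
by apply: shuffle_prod_comm => i; apply: gD.
Qed.

(** A generator that exchanges two equal letters passes through the product and
    comes out as the generator that exchanges these letters in the sorted word:
    the letter 0 preceded by k zeros sits at place k there, the letter 1
    preceded by k ones at place k after all the zeros. *)
Lemma shuffle_prod_flat g u c e : braided g -> distant g ->
  g (size u) * shuffle_prod g (u ++ c :: c :: e) =
    shuffle_prod g (u ++ c :: c :: e) *
    g (if c then zeros (u ++ c :: c :: e) + ones u else zeros u)%N.
Proof.
elim: u g => [|x u IH] g gB gD /=.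
  (* The rest of the word uses generators from 2 on. *)
  have T0 : g 0%N * shuffle_prod (fun i => g i.+2) e =
    shuffle_prod (fun i => g i.+2) e * g 0%N.
    by apply: shuffle_prod_comm => i; apply: gD.
  case: c => /=; last by rewrite !mulr1.
  by rewrite !add0n addn0 mulrA mulrA T0 -!mulrA cycle_prod_double // !mulrA.
rewrite mulrA [g _ * _](IH (fun i => g i.+1));
  [|exact: braidedS|exact: distantS].
rewrite -!mulrA {IH}; congr (_ * _); case: x => /=.
  (* The head letter 1 puts a cycle on the right; a generator of the ones is
     beyond this cycle, a generator of the zeros slides through it. *)
  case: c => /=; first by rewrite add0n addnCA add1n cycle_prod_far // ltnS
    leq_addr.
  by rewrite add0n cycle_prod_slide // count_cat /= !add1n !addnS
    !ltnS leq_addr.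
by case: c; rewrite /= mulr1 mul1r ?add1n ?addSn ?add0n.
Qed.

Lemma shuffle_prod_zeros g z e : shuffle_prod g (nseq z false ++ e) =
  shuffle_prod (fun i => g (z + i)%N) e.
Proof.
elim: z g => [|z IH] g; first exact: eq_shuffle_prod.
by rewrite /= mulr1 IH; apply: eq_shuffle_prod => i _; rewrite addSn.
Qed.

Lemma cycle_prodD g y z :
  cycle_prod g (y + z) = cycle_prod g y * cycle_prod (fun i => g (y + i)%N) z.
Proof. exact: big_split_ord. Qed.

Lemma shuffle_prod_cyc g z e : distant g ->
  shuffle_prod g (true :: nseq z false ++ e) =
    cycle_prod g z * shuffle_prod g (nseq z false ++ true :: e).
Proof.
move=> gD; rewrite /= !shuffle_prod_zeros /= count_cat count_nseq mul1n
  cycle_prodD !mulrA.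
congr (_ * _); rewrite (@eq_shuffle_prod _ (fun i => g (z + i.+1)%N));
  last first.
  by move=> i _; rewrite addnS.
apply/commr_sym/shuffle_prod_comm => i; apply/commr_sym; rewrite /GRing.comm.
by apply: cycle_prod_far; rewrite // addnS ltnS leq_addr.
Qed.

(** Sorting u ++ e can start with u alone; the letters 1 of u then have to
    cross the letters 0 of e as a block. *)
Lemma shuffle_prod_cat_sorted g u e : distant g ->
  shuffle_prod g (u ++ e) = shuffle_prod g u *
    shuffle_prod g (nseq (zeros u) false ++ nseq (ones u) true ++ e).
Proof.
elim: u g => [|c u IH] g gD /=; first by rewrite mul1r.
rewrite IH; last exact: distantS.
case: c => /=; last by rewrite !mulr1.
rewrite -!mulrA -shuffle_prod_cyc //; congr (_ * (_ * cycle_prod _ _)).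
by rewrite !count_cat !count_nseq mul1n mul0n.
Qed.

Lemma shuffle_prod_cat_suffix g u e :
  shuffle_prod g (u ++ e) = shuffle_prod (fun i => g (size u + i)%N) e *
    shuffle_prod g (u ++ nseq (zeros e) false ++ nseq (ones e) true).
Proof.
elim: u g => [|c u IH] g /=; first by rewrite shuffle_prod_sorted mulr1.
by rewrite IH -!mulrA !count_cat !count_nseq /= mul1n mul0n addn0.
Qed.

(** A word cut after t + s letters, with both parts sorted.  These words stand
    for the double cosets of two Young subgroups with two blocks each. *)
Definition blocks t s p q :=
  nseq t false ++ nseq s true ++ nseq p false ++ nseq q true.

Lemma size_zeros_ones u : (zeros u + ones u)%N = size u.
Proof.
rewrite -(count_predC (pred1 false) u); congr (_ + _)%N.
by apply: eq_count => -[].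
Qed.

(** The minimal coset representative of u ++ e factors through the double coset
    representative: sort both halves independently, then sort the four blocks
    that remain. *)
Lemma shuffle_prod_cat g u e : distant g ->
  shuffle_prod g (u ++ e) =
    shuffle_prod g u * shuffle_prod (fun i => g (size u + i)%N) e *
    shuffle_prod g (blocks (zeros u) (ones u) (zeros e) (ones e)).
Proof.
move=> gD; rewrite shuffle_prod_cat_sorted // catA shuffle_prod_cat_suffix
  -catA.
by rewrite mulrA size_cat !size_nseq size_zeros_ones.
Qed.

End ShuffleProducts.

Lemma rmorph_shuffle_prod (A A' : nzRingType) (f : {rmorphism A -> A'}) g d :
  f (shuffle_prod g d) = shuffle_prod (fun i => f (g i)) d.
Proof.
elim: d g => [|c d IH] g /=; first exact: rmorph1.
by rewrite rmorphM IH; case: c; rewrite ?rmorph1 // /cycle_prod rmorph_prod.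
Qed.

(** * The algebra of linear endomorphisms *)

Section EndomorphismAlgebra.
Variables (K : fieldType) (V : lmodType K) (v0 : V) (v0_neq0 : v0 != 0).

(** The hypothesis that V is nonzero is an argument because an algebra over K is
    required to have 1 != 0. *)
Definition endo of v0 != 0 : Type := {f : V -> V | linear f}.
Local Notation E := (endo v0_neq0).
HB.instance Definition _ := gen_eqMixin E.
HB.instance Definition _ := gen_choiceMixin E.

Definition endo_app (f : E) : V -> V := sval f.

Lemma endo_linear (f : E) : linear (endo_app f).
Proof. exact: svalP. Qed.

Lemma endoP (f g : E) : endo_app f =1 endo_app g -> f = g.
Proof. by case: f g => [f fL] [g gL] /funext /= fg; exact: eq_exist. Qed.

Lemma endo_appZ (f : E) : scalable (endo_app f).
Proof.
move=> c v; have f0 : endo_app f 0 = 0.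
  by have := endo_linear f (-1) 0 0; rewrite !scaleN1r addr0 oppr0 addNr.
by have := endo_linear f c v 0; rewrite f0 !addr0.
Qed.

Lemma endo_appD (f : E) : {morph endo_app f : v w / v + w}.
Proof. by move=> v w; have := endo_linear f 1 v w; rewrite !scale1r. Qed.

Definition endo_add (f g : E) : E.
Proof.
exists (fun v => endo_app f v + endo_app g v) => c v w.
by rewrite !endo_linear scalerDr addrACA.
Defined.

Definition endo_opp (f : E) : E.
Proof.
exists (fun v => - endo_app f v) => c v w.
by rewrite endo_linear opprD scalerN.
Defined.

Definition endo_zero : E.
Proof. by exists (fun v => 0) => c v w; rewrite scaler0 addr0. Defined.

Definition endo_mul (f g : E) : E.
Proof.
by exists (fun v => endo_app f (endo_app g v)) => c v w; rewrite !endo_linear.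
Defined.

Definition endo_one : E.
Proof. by exists (fun v => v). Defined.

Definition endo_scale (c : K) (f : E) : E.
Proof.
exists (fun v => c *: endo_app f v) => d v w.
by rewrite endo_linear scalerDr !scalerA mulrC.
Defined.

Fact endo_addA : associative endo_add.
Proof. by move=> f g h; apply: endoP => v; exact: addrA. Qed.
Fact endo_addC : commutative endo_add.
Proof. by move=> f g; apply: endoP => v; exact: addrC. Qed.
Fact endo_add0 : left_id endo_zero endo_add.
Proof. by move=> f; apply: endoP => v; exact: add0r. Qed.
Fact endo_addN : left_inverse endo_zero endo_opp endo_add.
Proof. by move=> f; apply: endoP => v; exact: addNr. Qed.

HB.instance Definition _ := GRing.isZmodule.Build E
  endo_addA endo_addC endo_add0 endo_addN.

Fact endo_mulA : associative endo_mul.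
Proof. by move=> f g h; apply: endoP. Qed.
Fact endo_mul1 : left_id endo_one endo_mul.
Proof. by move=> f; apply: endoP. Qed.
Fact endo_mulr1 : right_id endo_one endo_mul.
Proof. by move=> f; apply: endoP. Qed.
Fact endo_mulDl : left_distributive endo_mul +%R.
Proof. by move=> f g h; apply: endoP. Qed.
Fact endo_mulDr : right_distributive endo_mul +%R.
Proof. by move=> f g h; apply: endoP => v; exact: endo_appD. Qed.
Fact endo_1neq0 : endo_one != 0.
Proof. by apply/eqP => /(congr1 (endo_app^~ v0))/eqP; apply/negP. Qed.

HB.instance Definition _ := GRing.Zmodule_isNzRing.Build E
  endo_mulA endo_mul1 endo_mulr1 endo_mulDl endo_mulDr endo_1neq0.

Fact endo_scaleA c d f : endo_scale c (endo_scale d f) = endo_scale (c * d) f.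
Proof. by apply: endoP => v; exact: scalerA. Qed.
Fact endo_scale1 : left_id 1 endo_scale.
Proof. by move=> f; apply: endoP => v; exact: scale1r. Qed.
Fact endo_scaleDr : right_distributive endo_scale +%R.
Proof. by move=> c f g; apply: endoP => v; exact: scalerDr. Qed.
Fact endo_scaleDl f : {morph endo_scale^~ f : c d / c + d}.
Proof. by move=> c d; apply: endoP => v; exact: scalerDl. Qed.

HB.instance Definition _ := GRing.Zmodule_isLmodule.Build K E
  endo_scaleA endo_scale1 endo_scaleDr endo_scaleDl.

Fact endo_scaleAl (c : K) (f g : E) : c *: (f * g) = (c *: f) * g.
Proof. exact: endoP. Qed.

HB.instance Definition _ := GRing.Lmodule_isLalgebra.Build K E endo_scaleAl.

Fact endo_scaleAr (c : K) (f g : E) : c *: (f * g) = f * (c *: g).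
Proof. by apply: endoP => v; exact/esym/endo_appZ. Qed.

HB.instance Definition _ := GRing.Lalgebra_isAlgebra.Build K E endo_scaleAr.

End EndomorphismAlgebra.

(** * Morphisms out of a Hecke algebra *)

Section HeckeLift.
Variables (K : closedFieldType) (a b : K) (n : nat) (C : algType K).
Variable x : 'I_n.-1 -> C.
Hypothesis x_quad : forall i, x i ^+ 2 = a *: x i + b%:A.
Hypothesis x_braid : forall i j : 'I_n.-1, j = i.+1 :> nat ->
  x i * x j * x i = x j * x i * x j.
Hypothesis x_comm : forall i j : 'I_n.-1, (i.+1 < j)%N -> x i * x j = x j * x i.

Lemma hecke_lift_exists :
  exists f : {lrmorphism hecke a b n -> C}, forall i, f (hgen a b i) = x i.
Proof.
pose f := free_alg_lift x.
have fE i : f (fgen K i) = x i by exact: free_alg_lift_gen.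
have f0 y : hecke_rel a b y -> f y = 0.
  case=> {y} [i|i j ij|i j ij].
  - by rewrite (morph_quad a b f) fE x_quad subrr.
  - by rewrite (morph_braid f) !fE x_braid // subrr.
  rewrite (morph_comm f) !fE.
  case: (ltngtP i j) => [lt_ij|lt_ji|/val_inj->]; last exact: subrr.
    by rewrite x_comm ?subrr //; lia.
  by rewrite -(@x_comm j i) ?subrr //; lia.
exists (quot_lift (@hecke_proper K a b n) f0) => i.
by rewrite [LHS]quot_liftE.
Qed.

End HeckeLift.

(** * The Hecke relations for operators on words *)

(** Brings the pair of letters at the places i and i + 1 into the open. *)
Lemma word_split i (w : seq bool) : (i.+1 < size w)%N ->
  exists u x y e, size u = i /\ w = u ++ x :: y :: e.
Proof.
move=> iw; exists (take i w), (nth false w i), (nth false w i.+1),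
  (drop i.+2 w).
rewrite size_take (ltn_trans _ iw) //; split=> //.
by rewrite -!drop_nth ?cat_take_drop // (ltn_trans _ iw).
Qed.

Section WordAction.
Variables (K : fieldType) (a b : K) (B : algType K) (X Y : nat -> B).
Implicit Types (h : seq bool -> B) (u w e : seq bool).

Definition swap_word i w :=
  take i w ++ nth false w i.+1 :: nth false w i :: drop i.+2 w.

(** The action of the i-th generator on functions h from words to B, written
    after the rules for its product with the basis element of a word: it moves
    01 to 10, it moves 10 to 01 up to the quadratic relation, and it passes
    through two equal letters as a generator X or Y of B.  The rules are
    transposed, since they describe basis elements and h is a function. *)
Definition word_op i h w : B :=
  if nth false w i == nth false w i.+1 then
    (if nth false w i then Y (ones (take i w)) else X (zeros (take i w))) * h w
  else if nth false w i then h (swap_word i w) + a *: h w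
  else b *: h (swap_word i w).

Lemma nth_size_cat u x y e : (nth false (u ++ x :: y :: e) (size u) = x) *
  (nth false (u ++ x :: y :: e) (size u).+1 = y).
Proof. by split; elim: u. Qed.

Lemma swap_wordE u x y e : swap_word (size u) (u ++ x :: y :: e) =
  u ++ y :: x :: e.
Proof.
rewrite /swap_word take_size_cat // !nth_size_cat; congr (_ ++ _ :: _ :: _).
by elim: u; rewrite /= ?drop0.
Qed.

Lemma word_opE h u x y e : word_op (size u) h (u ++ x :: y :: e) =
  if x == y then (if x then Y (ones u) else X (zeros u)) * h (u ++ x :: y :: e)
  else if x then h (u ++ y :: x :: e) + a *: h (u ++ x :: y :: e)
  else b *: h (u ++ y :: x :: e).
Proof. by rewrite /word_op swap_wordE take_size_cat // !nth_size_cat. Qed.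

Lemma word_opES h u z x y e : word_op (size u).+1 h (u ++ z :: x :: y :: e) =
  if x == y then (if x then Y (ones u + z) else X (zeros u + ~~ z))%N * 
     h (u ++ z :: x :: y :: e)
  else if x then h (u ++ z :: y :: x :: e) + a *: h (u ++ z :: x :: y :: e)
  else b *: h (u ++ z :: y :: x :: e).
Proof.
have := word_opE h (rcons u z) x y e.
rewrite size_rcons !cat_rcons -!cats1 !count_cat /= !addn0 => ->.
by case: z.
Qed.

Lemma eq_word_op i h h' w : (i.+1 < size w)%N ->
  (forall w', zeros w' = zeros w -> ones w' = ones w -> h w' = h' w') ->
  word_op i h w = word_op i h' w.
Proof.
move=> iw hh; have [u [x [y [e [<- wE]]]]] := word_split iw.
rewrite {}wE in hh *; rewrite !word_opE !hh // !count_cat /=; lia.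
Qed.

Section Relations.
Hypotheses (XB : braided X) (YB : braided Y) (XD : distant X) (YD : distant Y).
Hypothesis XY : forall i j, X i * Y j = Y j * X i.

Variables m n : nat.
Hypothesis XQ : forall i, (i.+1 < m)%N -> X i ^+ 2 = a *: X i + b%:A.
Hypothesis YQ : forall i, (i.+1 < n)%N -> Y i ^+ 2 = a *: Y i + b%:A.

Let XX i (c : B) : (i.+1 < m)%N -> X i * (X i * c) = a *: (X i * c) + b *: c.
Proof. by move=> im; rewrite mulrA -expr2 XQ // mulrDl -scalerAl mulr_algl. Qed.

Let YY i (c : B) : (i.+1 < n)%N -> Y i * (Y i * c) = a *: (Y i * c) + b *: c.
Proof. by move=> im; rewrite mulrA -expr2 YQ // mulrDl -scalerAl mulr_algl. Qed.

(** Only the two letters at the places i and i + 1 are involved; for equal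
    letters the relation is inherited from X or Y. *)
Lemma word_op_quad i h w : (i.+1 < size w)%N -> zeros w = m -> ones w = n ->
  word_op i (word_op i h) w = a *: word_op i h w + b *: h w.
Proof.
move=> iw; have [u [x [y [e [<- {iw}->]]]]] := word_split iw.
rewrite !count_cat /= => wm wn; rewrite !word_opE.
case: x y wm wn => -[] /= wm wn.
- by rewrite YY //; clear -wn; lia.
- by rewrite addrC.
- by rewrite scalerDr !scalerA addrC mulrC.
- by rewrite XX //; clear -wm; lia.
Qed.

(** Eight cases, one for each choice of the three letters involved.  Three equal
    letters use the braid relation of X or Y.  When the letters are 110 or 100,
    one side contains the square of a generator of B, and the quadratic relation
    turns it into the other side. *)
Lemma word_op_braid i h w : (i.+2 < size w)%N -> zeros w = m -> ones w = n ->
  word_op i (word_op i.+1 (word_op i h)) w =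
    word_op i.+1 (word_op i (word_op i.+1 h)) w.
Proof.
move=> iw; have [u [x [y [e [uE wE]]]]] := word_split (ltnW iw).
rewrite {}wE -uE size_cat in iw *.
case: e iw => [|z e _]; first by rewrite addn2 ltnn.
rewrite !count_cat /= => wm wn.
case: x y z wm wn => -[] -[] /= wm wn;
  do 3!rewrite ?(word_opE, word_opES) /=; rewrite ?addn0 ?addn1.
all: rewrite ?YY ?XX ?mulrA ?XB ?YB //; try by clear -wm wn; lia.
all: rewrite ?(mulrDr, scalerDr, mulrDl) -?scalerAr ?scalerA ?addrA //.
(* letters 110: the quadratic relation of Y *)
- rewrite YY; last by clear -wn; lia.
  by rewrite scalerDr !scalerA addrA [X in _ = X + _]addrAC [RHS]addrAC.
- by rewrite mulrC.
(* letters 100: the quadratic relation of X *)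
- rewrite XX; last by clear -wm; lia.
  by rewrite scalerDr !scalerA addrA [X in X + _ = _]addrAC [LHS]addrAC.
- by rewrite mulrC.
Qed.

(** The two pairs of letters are disjoint, and exchanging the first pair does
    not change the number of zeros and ones in front of the second. *)
Lemma word_op_comm i j h w : (i.+1 < j)%N -> (j.+1 < size w)%N ->
  word_op i (word_op j h) w = word_op j (word_op i h) w.
Proof.
move=> ij jw; have [u' [x' [y' [e [u'E wE]]]]] := word_split jw.
have [u [x [y [v [uE uE']]]]] : exists u x y v, size u = i /\ u' =
  u ++ x :: y :: v.
  by apply: word_split; rewrite u'E.
rewrite {}wE -u'E uE' -uE -catA size_cat /= {jw ij uE uE' u'E w u' i j}.
pose W x0 y0 x1 y1 := u ++ [:: x0, y0 & v ++ [:: x1, y1 & e]].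
have E h' x0 y0 x1 y1 : word_op (size u + (size v).+2) h' (W x0 y0 x1 y1) =
    if x1 == y1 then
      (if x1 then Y (ones u + (x0 + y0 + ones v))
       else X (zeros u + (~~ x0 + ~~ y0 + zeros v)))%N * h' (W x0 y0 x1 y1)
    else if x1 then h' (W x0 y0 y1 x1) + a *: h' (W x0 y0 x1 y1)
    else b *: h' (W x0 y0 y1 x1).
  have := word_opE h' (u ++ [:: x0, y0 & v]) x1 y1 e.
  rewrite -!catA /= !count_cat /= !addnA !size_cat => ->.
  by case: (x0) (y0) => -[].
rewrite {}/W in E *.
case: x y x' y' => -[] -[] -[];
  do 2!rewrite ?(E, word_opE) /=;
  rewrite -?scalerAr ?mulrDr ?scalerDr -?scalerAr ?scalerA.
all: rewrite ?add0n ?addn0 // ?addrA; rewrite ?mulrA.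
- by rewrite YD // add1n -addn2 leq_add2l.
- by rewrite XY.
- by rewrite [X in X + _ = _]addrAC.
- by rewrite [a * b]mulrC.
- by rewrite [a * b]mulrC.
- by rewrite XY.
- by rewrite XD // add1n -addn2 leq_add2l.
Qed.
End Relations.
End WordAction.

(** * Generators and shuffles *)

Section Generators.
Variables (K : closedFieldType) (a b : K).
Local Notation H := (hecke a b).

(** Out of range the value is 0, for which the braid and commutation relations
    hold; only the quadratic relation needs a bound on the index. *)
Definition hgen_nat r (i : nat) : H r := oapp (@hgen K a b r) 0 (insub i).

Lemma hgE r (i : 'I_r.-1) : hgen_nat r i = hgen a b i.
Proof. by rewrite /hgen_nat valK. Qed.

Lemma hg_out r i : (r.-1 <= i)%N -> hgen_nat r i = 0.
Proof. by move=> ri; rewrite /hgen_nat insubF // ltnNge ri. Qed.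

Lemma hg_quad r i : (i.+1 < r)%N -> hgen_nat r i ^+ 2 =
  a *: hgen_nat r i + b%:A.
Proof.
move=> ir; have ir' : (i < r.-1)%N by lia.
by rewrite (hgE (Ordinal ir')) hgen_quad.
Qed.

Lemma hg_braided r : braided (hgen_nat r).
Proof.
move=> i; case: (ltnP i.+1 r.-1) => ir; last first.
  by rewrite (hg_out ir) !(mulr0, mul0r).
by rewrite (hgE (Ordinal ir)) (hgE (Ordinal (ltnW ir))) hgen_braid.
Qed.

Lemma hg_distant r : distant (hgen_nat r).
Proof.
move=> i j ij; case: (ltnP j r.-1) => jr; last first.
  by rewrite (hg_out jr) !(mulr0, mul0r).
have ir : (i < r.-1)%N by lia.
rewrite (hgE (Ordinal ir)) (hgE (Ordinal jr)) hgen_comm //=; lia.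
Qed.

Lemma hecke_shift_hg p r d (le : (d + p <= r)%N) i : (i < p.-1)%N ->
  hecke_shift a b le (hgen_nat p i) = hgen_nat r (d + i).
Proof.
by move=> ip; rewrite (hgE (Ordinal ip)) hecke_shiftE -hgE.
Qed.

Lemma hecke_shiftM p r d (le : (d + p <= r)%N) x y :
  hecke_shift a b le (x * y) = hecke_shift a b le x * hecke_shift a b le y.
Proof. exact: rmorphM. Qed.

End Generators.

Lemma nseq_split2 (x : bool) i m : (i.+1 < m)%N ->
  nseq i x ++ x :: x :: nseq (m - i.+2) x = nseq m x.
Proof. by move=> im; rewrite -[x :: _]/(nseq (m - i.+2).+2 x) -nseqD;
  congr nseq; lia. Qed.

Section Shuffles.
Variables m n : nat.

(** Words with m letters false and n letters true stand for the minimal left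
    coset representatives of S_m x S_n in S_(m+n). *)
Definition shuffle : Type := {d : (m + n).-tuple bool | zeros d == m}.
HB.instance Definition _ := Finite.on shuffle.

Definition word (d : shuffle) : seq bool := val (val d).

Lemma word_inj : injective word.
Proof. by move=> d e /val_inj/val_inj. Qed.

Lemma size_word d : size (word d) = (m + n)%N.
Proof. exact: size_tuple. Qed.

Lemma zeros_word d : zeros (word d) = m.
Proof. exact/eqP/(valP d). Qed.

Lemma ones_word d : ones (word d) = n.
Proof.
by apply/eqP; rewrite -(eqn_add2l m)
  -{1}(zeros_word d) size_zeros_ones size_word.
Qed.

Lemma wordP w : zeros w = m -> ones w = n -> exists d, word d = w.
Proof.
move=> wm wn; have ws : size w == (m + n)%N by rewrite -size_zeros_ones wm wn.
by exists (exist _ (Tuple ws) (introT eqP wm)).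
Qed.

Definition sorted_word := nseq m false ++ nseq n true.

Lemma zeros_sorted : zeros sorted_word = m.
Proof. by rewrite count_cat !count_nseq /= mul1n mul0n addn0. Qed.

Lemma ones_sorted : ones sorted_word = n.
Proof. by rewrite count_cat !count_nseq /= mul1n mul0n. Qed.

End Shuffles.

(** * Coordinates on the Hecke algebra *)

Section Representation.
Variables (K : closedFieldType) (a b : K) (m n : nat).
Local Notation H := (hecke a b).
Local Notation B := (H m \ot H n).
Local Notation P := {ffun shuffle m n -> B}.

Definition genl i : B := atens (hgen_nat a b m i) 1.
Definition genr i : B := atens 1 (hgen_nat a b n i).

Lemma genl_braided : braided genl.
Proof. by move=> i; rewrite /genl !atensM hg_braided. Qed.

Lemma genr_braided : braided genr.
Proof. by move=> i; rewrite /genr !atensM hg_braided. Qed.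

Lemma genl_distant : distant genl.
Proof. by move=> i j ij; rewrite /genl !atensM (hg_distant _ _ _ ij). Qed.

Lemma genr_distant : distant genr.
Proof. by move=> i j ij; rewrite /genr !atensM (hg_distant _ _ _ ij). Qed.

Lemma gen_comm i j : genl i * genr j = genr j * genl i.
Proof. by rewrite /genl /genr !atensM !(mulr1, mul1r). Qed.

Lemma genl_quad i : (i.+1 < m)%N -> genl i ^+ 2 = a *: genl i + b%:A.
Proof.
move=> im; rewrite expr2 /genl atensM mulr1 -expr2 hg_quad //.
by rewrite atensDl !atensZl.
Qed.

Lemma genr_quad i : (i.+1 < n)%N -> genr i ^+ 2 = a *: genr i + b%:A.
Proof.
move=> im; rewrite expr2 /genr atensM mulr1 -expr2 hg_quad //.
by rewrite atensDr !atensZr.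
Qed.

Definition single (w : seq bool) (c : B) : P :=
  [ffun d => if word d == w then c else 0].

(** The sum has at most one term; it extends f by 0 to all words, which lets the
    operators be computed on plain sequences. *)
Definition extend (f : P) (w : seq bool) : B := \sum_(d | word d == w) f d.

Lemma ext_word f d : extend f (word d) = f d.
Proof.
by apply: big_pred1 => e; rewrite /= (inj_eq (@word_inj _ _)).
Qed.

Lemma ext_linear c (f g : P) w : extend (c *: f + g) w =
  c *: extend f w + extend g w.
Proof.
by rewrite scaler_sumr -big_split; apply: eq_bigr => d _; rewrite !ffunE.
Qed.

Lemma ext_single w c w' : zeros w' = m -> ones w' = n ->
  extend (single w c) w' = if w' == w then c else 0.
Proof. by move=> wm wn; have [d <-] := wordP wm wn; rewrite ext_word ffunE. Qed.

Definition shuffle_op_fun i (f : P) : P :=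
  [ffun d => word_op a b genl genr i (extend f) (word d)].

Lemma op_linear i : linear (shuffle_op_fun i).
Proof.
move=> c f g; apply/ffunP => d; rewrite !ffunE /word_op !ext_linear.
case: ifP => _; first by rewrite mulrDr scalerAr.
case: ifP => _; rewrite !scalerDr !scalerA; last by rewrite mulrC.
by rewrite (mulrC a c) -!addrA; congr (_ + _); rewrite addrCA.
Qed.

(** The nonzero vector that the endomorphism algebra asks for. *)
Lemma single_sorted_neq0 : single (sorted_word m n) 1 != 0.
Proof.
apply/eqP => /ffunP.
have [d dE] := wordP (zeros_sorted m n) (ones_sorted m n).
by move=> /(_ d)/eqP; rewrite !ffunE dE eqxx oner_eq0.
Qed.

Local Notation E := (endo single_sorted_neq0).

Definition shuffle_op i : E := exist _ _ (op_linear i).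

Lemma shuffle_opE i f : endo_app (shuffle_op i) f = shuffle_op_fun i f.
Proof. by []. Qed.

(** An operator keeps the numbers of zeros and ones, so iterating it never
    evaluates a function at a word outside its domain, and the relations for
    functions of all words carry over. *)
Lemma ops_word (s : seq nat) f d : all (fun i => i.+1 < m + n)%N s ->
  foldr shuffle_op_fun f s d =
    foldr (word_op a b genl genr) (extend f) s (word d).
Proof.
elim: s d => [|i s IH] d /=; first by rewrite ext_word.
case/andP=> ir sr; rewrite ffunE; apply: eq_word_op; first by rewrite size_word.
move=> w; rewrite zeros_word ones_word => /wordP/[apply] -[d' <-].
by rewrite ext_word IH.
Qed.

Lemma rep_exists : exists rho : {lrmorphism H (m + n) -> E},
  forall i : 'I_(m + n).-1, rho (hgen a b i) = shuffle_op i.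
Proof.
have lt_ord (i : 'I_(m + n).-1) : (i.+1 < m + n)%N by move: (ltn_ord i); lia.
apply: (@hecke_lift_exists _ _ _ _ E (fun i : 'I_(m + n).-1 => shuffle_op i)).
- move=> i; apply: endoP => f; apply/ffunP => d.
  rewrite [LHS](@ops_word [:: val i; val i] f d) /= ?lt_ord //.
  rewrite (word_op_quad genl_quad genr_quad) ?size_word ?zeros_word
    ?ones_word //.
  by rewrite ext_word !ffunE.
- move=> i j ij; apply: endoP => f; apply/ffunP => d.
  rewrite [LHS](@ops_word [:: val i; val j; val i] f d) /= ?lt_ord //.
  rewrite [RHS](@ops_word [:: val j; val i; val j] f d) /= ?lt_ord //.
  rewrite [val j]ij.
  apply: (word_op_braid genl_braided genr_braided genl_quad genr_quad).
  + by rewrite size_word -ij.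
  + exact: zeros_word.
  + exact: ones_word.
- move=> i j ij; apply: endoP => f; apply/ffunP => d.
  rewrite [LHS](@ops_word [:: val i; val j] f d) /= ?lt_ord //.
  rewrite [RHS](@ops_word [:: val j; val i] f d) /= ?lt_ord //.
  by apply: (word_op_comm _ _ genl_distant genr_distant gen_comm);
    rewrite ?size_word.
Qed.

Definition shuffle_rep : {lrmorphism H (m + n) -> E} := sval (cid rep_exists).

Lemma rep_mul x y f :
  endo_app (shuffle_rep (x * y)) f =
    endo_app (shuffle_rep x) (endo_app (shuffle_rep y) f).
Proof. by rewrite (rmorphM shuffle_rep). Qed.

Lemma rep_hg i : (i.+1 < m + n)%N -> shuffle_rep (hgen_nat a b (m + n) i) =
  shuffle_op i.
Proof.
move=> ir; have ir' : (i < (m + n).-1)%N by lia.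
by rewrite (hgE a b (Ordinal ir')) /shuffle_rep; case: cid.
Qed.

(** The rules in word_op are transposed; on functions supported at one word the
    operators show the rules for basis elements themselves. *)
Lemma op_up u e c : let w := u ++ false :: true :: e in
  zeros w = m -> ones w = n ->
  endo_app (shuffle_op (size u)) (single w c) =
    single (u ++ true :: false :: e) c.
Proof.
move=> w wm wn; apply/ffunP => d; rewrite !ffunE.
have wr : ((size u).+1 < m + n)%N.
  by rewrite -wm -wn size_zeros_ones size_cat /= !addnS !ltnS leq_addr.
have [u' [x [y [e' [u'E dE]]]]] : exists u' x y e', size u' = size u /\ word d =
  u' ++ x :: y :: e'.
  by apply: word_split; rewrite size_word.
rewrite dE -u'E word_opE.
have := zeros_word d; have := ones_word d; rewrite dE !count_cat /= => dn dm.
rewrite !ext_single ?count_cat //=; try lia.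
rewrite !eqseq_cat //.
by case: x y {dE dn dm} => -[] /=; rewrite ?andbF ?mulr0 ?scaler0 ?addr0.
Qed.

Lemma op_flat u x e c : let w := u ++ x :: x :: e in
  zeros w = m -> ones w = n ->
  endo_app (shuffle_op (size u)) (single w c) =
  single w ((if x then genr (ones u) else genl (zeros u)) * c).
Proof.
move=> w wm wn; apply/ffunP => d; rewrite !ffunE.
have wr : ((size u).+1 < m + n)%N.
  by rewrite -wm -wn size_zeros_ones size_cat /= !addnS !ltnS leq_addr.
have [u' [x' [y [e' [u'E dE]]]]] : exists u' x y e', size u' =
  size u /\ word d = u' ++ x :: y :: e'.
  by apply: word_split; rewrite size_word.
rewrite dE -u'E word_opE.
have := zeros_word d; have := ones_word d; rewrite dE !count_cat /= => dn dm.
rewrite !ext_single ?count_cat //=; try lia.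
rewrite !eqseq_cat // !eqseq_cons.
case: x x' y {w wm wn dE dn dm} => -[] -[] /=;
  rewrite ?andbF ?scaler0 ?addr0 ?mulr0 //.
all: by case: eqP => [->|_] /=; rewrite ?mulr0 //; case: ifP; rewrite ?mulr0.
Qed.

(** The letter 1 moves to the left over the z letters 0 one place at a time,
    each time by the rule for 01. *)
Lemma op_cyc u z e c : let w := u ++ nseq z false ++ true :: e in
  zeros w = m -> ones w = n ->
  endo_app (cycle_prod (fun i => shuffle_op (size u + i)%N) z) (single w c) =
  single (u ++ true :: nseq z false ++ e) c.
Proof.
elim: z e => [|z IH] e /=; first by rewrite cycle_prod0.
move=> wm wn; rewrite cycle_prod_recr
  -[LHS]/(endo_app _ (endo_app (shuffle_op _) _)).
have -> : u ++ false :: nseq z false ++ true :: e =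
          (u ++ nseq z false) ++ false :: true :: e.
  by rewrite -[false :: _]/(nseq z.+1 false ++ _) -addn1 nseqD -!catA.
have -> : (size u + z)%N = size (u ++ nseq z false).
  by rewrite size_cat size_nseq.
rewrite op_up; first last.
- by rewrite -wn !count_cat /= !count_cat /= !count_nseq; lia.
- by rewrite -wm !count_cat /= !count_cat /= !count_nseq; lia.
rewrite -catA IH; first last.
- by rewrite -wn !count_cat /= !count_cat /= !count_nseq; lia.
- by rewrite -wm !count_cat /= !count_cat /= !count_nseq; lia.
congr (single (u ++ true :: _) c).
by rewrite -[false :: (_ ++ _)]/(nseq z.+1 false ++ _) -addn1 nseqD -!catA.
Qed.

(** The prefix u is what the recursion has already put in place; it shifts the
    places on which the remaining generators act. *)
Lemma op_shuffle_prod u d c : zeros (u ++ d) = m -> ones (u ++ d) = n ->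
  endo_app (shuffle_prod (fun i => shuffle_op (size u + i)%N) d)
    (single (u ++ sorted_word (zeros d) (ones d)) c) = single (u ++ d) c.
Proof.
elim: d u => [|x d IH] u //= um un.
rewrite -[LHS]/(endo_app _ (endo_app _ _)).
have -> : shuffle_prod (fun i => shuffle_op (size u + i.+1)%N) d =
  shuffle_prod (fun i => shuffle_op (size (rcons u x) + i)%N) d.
  by apply: eq_shuffle_prod => i _; rewrite size_rcons addnS.
have := IH (rcons u x); rewrite cat_rcons => /(_ um un) <-;
  congr (endo_app _ _).
rewrite cat_rcons; case: x um un => um un.
  rewrite -[sorted_word _ (_ + _)]/(nseq (zeros d) _ ++ true :: nseq (ones d)
    true).
  have E1 : true :: nseq (ones d) true = nseq (ones d).+1 true by [].
  rewrite (op_cyc (e := nseq (ones d) true)) // E1.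
  - by rewrite -um !count_cat !count_nseq /=; lia.
  - by rewrite -un !count_cat !count_nseq /=; lia.
by [].
Qed.

Lemma rep_shuffle_prod (d : shuffle m n) c :
  endo_app (shuffle_rep (shuffle_prod (hgen_nat a b (m + n)) (word d)))
    (single (sorted_word m n) c) =
  single (word d) c.
Proof.
have := @op_shuffle_prod [::] (word d) c (zeros_word d) (ones_word d).
rewrite zeros_word ones_word => <-; rewrite rmorph_shuffle_prod;
  congr (endo_app _ _).
by apply: eq_shuffle_prod => i; rewrite size_word => ir; apply: rep_hg; lia.
Qed.

(** The right action of B on functions; it commutes with all operators because
    the generators of B are multiplied from the left. *)
Definition rmulP (f : P) (c : B) : P := [ffun d => f d * c].

Lemma rep_rmul x f c : endo_app (shuffle_rep x) (rmulP f c) =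
  rmulP (endo_app (shuffle_rep x) f) c.
Proof.
elim/hecke_ind: x f => [|x y IHx IHy|k x IH||i x IH] f.
- by rewrite raddf0; apply/ffunP => d; rewrite !ffunE mul0r.
- rewrite raddfD -[LHS]/(endo_app _ _ + endo_app _ _) IHx IHy.
  by apply/ffunP => d; rewrite !ffunE mulrDl.
- rewrite linearZ -[LHS]/(k *: endo_app _ _) IH.
  by apply/ffunP => d; rewrite !ffunE scalerAl.
- by rewrite rmorph1.
- rewrite !rep_mul IH -hgE rep_hg ?shuffle_opE; last by move: (ltn_ord i); lia.
  move: (endo_app _ f) => {}f; apply/ffunP => d; rewrite !ffunE /word_op.
  have E w : extend (rmulP f c) w = extend f w * c.
    by rewrite mulr_suml; apply: eq_bigr => d' _; rewrite !ffunE.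
  rewrite !E; case: ifP => _; first by rewrite mulrA.
  by case: ifP => _; rewrite ?mulrDl ?scalerAl.
Qed.

Local Notation f := (hecke_emb a b (erefl (m + n)%N)).

Lemma op_sortedl i c : (i.+1 < m)%N ->
  endo_app (shuffle_op i) (single (sorted_word m n) c) =
  single (sorted_word m n) (genl i * c).
Proof.
move=> im; have := @op_flat (nseq i false) false
  (nseq (m - i.+2) false ++ nseq n true) c.
have -> : nseq i false ++ [:: false,
  false & nseq (m - i.+2) false ++ nseq n true] = sorted_word m n.
  by rewrite /sorted_word -(nseq_split2 false im) -catA.
rewrite size_nseq count_nseq mul1n.
by apply; [exact: zeros_sorted | exact: ones_sorted].
Qed.

Lemma op_sortedr i c : (i.+1 < n)%N ->
  endo_app (shuffle_op (m + i)) (single (sorted_word m n) c) =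
  single (sorted_word m n) (genr i * c).
Proof.
move=> i_n; have := @op_flat (nseq m false ++ nseq i true) true
  (nseq (n - i.+2) true) c.
rewrite -catA (nseq_split2 true i_n) size_cat !size_nseq count_cat
  !count_nseq mul1n mul0n add0n.
by apply; [exact: zeros_sorted | exact: ones_sorted].
Qed.

Lemma rep_shift p d (le : (d + p <= m + n)%N) (g : {rmorphism H p -> B}) :
  scalable g ->
  (forall i c, (i.+1 < p)%N ->
    endo_app (shuffle_op (d + i)) (single (sorted_word m n) c) =
     single (sorted_word m n) (g (hgen_nat a b p i) * c)) ->
  forall x c, endo_app (shuffle_rep (hecke_shift a b le x))
    (single (sorted_word m n) c) =
    single (sorted_word m n) (g x * c).
Proof.
move=> gZ gE; elim/hecke_ind => [|x y IHx IHy|k x IH||i x IH] c.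
- rewrite !raddf0 mul0r; apply/ffunP => e.
  by rewrite !ffunE if_same.
- rewrite !raddfD -[LHS]/(endo_app _ _ + endo_app _ _) IHx IHy.
  by apply/ffunP => e; rewrite !ffunE mulrDl; case: ifP; rewrite ?addr0.
- rewrite gZ !linearZ -[LHS]/(k *: endo_app _ _) IH.
  by apply/ffunP => e; rewrite !ffunE -scalerAl; case: ifP; rewrite ?scaler0.
- by rewrite !rmorph1 mul1r.
- rewrite hecke_shiftM rep_mul IH -hgE hecke_shift_hg // rep_hg;
  last by move: (ltn_ord i); lia.
  by rewrite gE ?rmorphM ?mulrA //; move: (ltn_ord i); lia.
Qed.

(** On the sorted word the subalgebra acts by left multiplication, as all its
    generators exchange equal letters there. *)
Lemma rep_emb c d :
  endo_app (shuffle_rep (f c)) (single (sorted_word m n) d) =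
  single (sorted_word m n) (c * d).
Proof.
elim/talg_ind: c => [|s t IHs IHt|x y].
- rewrite !raddf0 mul0r; apply/ffunP => e.
  by rewrite !ffunE if_same.
- rewrite !raddfB -[LHS]/(endo_app _ _ - endo_app _ _) IHs IHt.
  by apply/ffunP => e; rewrite !ffunE mulrBl; case: ifP; rewrite ?subr0.
rewrite (talg_liftE (@hecke_emb_comm K a b m n _ (erefl _))) rep_mul.
rewrite (@rep_shift _ _ _ (@tinr K (H m) (H n))) //; first last.
- by move=> i e; exact: op_sortedr.
- exact: tinr_is_scalable.
rewrite (@rep_shift _ _ _ (@tinl K (H m) (H n))) //; first last.
- by move=> i e; exact: op_sortedl.
- exact: tinl_is_scalable.
by rewrite mulrA [X in X * _]atensM mulr1 mul1r.
Qed.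

(** The coordinate of x at d, for the right basis indexed by shuffles: in the
    representation on functions the basis elements send the function supported
    at the sorted word to the functions supported at their own words. *)
Definition coord (d : shuffle m n) (x : H (m + n)) : B :=
  endo_app (shuffle_rep x) (single (sorted_word m n) 1) d.

Lemma coordD d : {morph coord d : x y / x + y}.
Proof.
by move=> x y; rewrite /coord raddfD
  -[endo_app _ _]/(endo_app (shuffle_rep x) _ + endo_app (shuffle_rep y) _)
  ffunE.
Qed.

Lemma coordMr d x c : coord d (x * f c) = coord d x * c.
Proof.
rewrite /coord rep_mul rep_emb mulr1.
have -> : single (sorted_word m n) c = rmulP (single (sorted_word m n) 1) c.
  by apply/ffunP => e; rewrite !ffunE; case: ifP => _; rewrite ?mul1r ?mul0r.
by rewrite rep_rmul ffunE.
Qed.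

Lemma coord_shuffle_prod (d d' : shuffle m n) :
  coord d (shuffle_prod (hgen_nat a b (m + n)) (word d')) =
    if d == d' then 1 else 0.
Proof. by rewrite /coord rep_shuffle_prod ffunE (inj_eq (@word_inj _ _)). Qed.

End Representation.

(** * The Hecke algebra is spanned by shuffles *)

Section TensorDifference.
Variables (K : fieldType) (A B : algType K).

Lemma atensBl (y : B) : zmod_morphism (fun x : A => atens x y).
Proof. by move=> x x'; apply/eqP; rewrite eq_sym subr_eq -atensDl addrNK. Qed.

Lemma atensBr (x : A) : zmod_morphism (fun y : B => atens x y).
Proof. by move=> y y'; apply/eqP; rewrite eq_sym subr_eq -atensDr addrNK. Qed.

End TensorDifference.

Lemma talg4_ind (K : fieldType) (A B C D : algType K)
    (P : (A \ot B) \ot (C \ot D) -> Prop) :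
  P 0 -> (forall s t, P s -> P t -> P (s - t)) ->
  (forall x y z w, P (atens (atens x y) (atens z w))) -> forall t, P t.
Proof.
move=> P0 PB PT; elim/talg_ind => // s t.
elim/talg_ind: s => [|s s' IH IH'|x y].
- by rewrite (zmod_morphism0 (atensBl t)).
- by rewrite atensBl; exact: PB.
elim/talg_ind: t => [|t t' IH IH'|z w] //.
- by rewrite (zmod_morphism0 (atensBr _)).
- by rewrite atensBr; exact: PB.
Qed.

Section Span.
Variables (K : closedFieldType) (a b : K).
Local Notation H := (hecke a b).
Local Notation T r := (shuffle_prod (hgen_nat a b r)).

Lemma hecke_emb_atens m n r (e : (m + n)%N = r) x y :
  hecke_emb a b e (atens x y) =
  hecke_shift a b (hecke_emb_subproofl e) x *
    hecke_shift a b (hecke_emb_subproofr e) y.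
Proof. exact: talg_liftE. Qed.

Lemma hecke_emb_left m n r (e : (m + n)%N = r) i : (i.+1 < m)%N ->
  hecke_emb a b e (genl a b m n i) = hgen_nat a b r i.
Proof.
by move=> im; rewrite hecke_emb_atens hecke_shift_hg ?rmorph1 ?mulr1 //; lia.
Qed.

Lemma hecke_emb_right m n r (e : (m + n)%N = r) i : (i.+1 < n)%N ->
  hecke_emb a b e (genr a b m n i) = hgen_nat a b r (m + i).
Proof.
by move=> im; rewrite hecke_emb_atens hecke_shift_hg ?rmorph1 ?mul1r //; lia.
Qed.

Section Fixed.
Variables (m n r : nat) (e : (m + n)%N = r).

(** The additive span of the multiples of the basis elements, as an intersection
    of predicates; closure properties then need no explicit coefficients. *)
Definition spanned (x : H r) : Prop := forall P : H r -> Prop,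
  P 0 -> (forall x y, P x -> P y -> P (x - y)) ->
  (forall (d : shuffle m n) c, P (T r (word d) * hecke_emb a b e c)) -> P x.

Lemma spanned0 : spanned 0.
Proof. by []. Qed.

Lemma spannedB x y : spanned x -> spanned y -> spanned (x - y).
Proof. by move=> xS yS P P0 PB PT;
  exact: (PB _ _ (xS P P0 PB PT) (yS P P0 PB PT)). Qed.

Lemma spannedD x y : spanned x -> spanned y -> spanned (x + y).
Proof.
by move=> xS yS; rewrite -[y]opprK -[- y]sub0r; do !apply: spannedB => //.
Qed.

Lemma spanned_shuffle_prod (d : shuffle m n) c :
  spanned (T r (word d) * hecke_emb a b e c).
Proof. by move=> P _ _; apply. Qed.

Lemma spanned_map (g : H r -> H r) : zmod_morphism g ->
  (forall (d : shuffle m n) c,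
    spanned (g (T r (word d) * hecke_emb a b e c))) ->
  forall x, spanned x -> spanned (g x).
Proof.
move=> gB gT x xS; apply: (xS (fun x => spanned (g x))); last exact: gT.
  by rewrite (zmod_morphism0 gB); exact: spanned0.
by move=> y z; rewrite gB; exact: spannedB.
Qed.

Lemma spannedZ k x : spanned x -> spanned (k *: x).
Proof.
apply: (spanned_map (g := fun x => k *: x)) => [y z|d c]; first exact: scalerBr.
by rewrite scalerAr -linearZ; exact: spanned_shuffle_prod.
Qed.

(** The span is a left ideal by the rules for a pair of letters: equal letters
    (shuffle_prod_flat), 01 (shuffle_prod_up), and 10, where the product comes
    from 01 and the quadratic relation applies. *)
Lemma spanned_hgen i x : spanned x -> spanned (hgen a b i * x).
Proof.
apply: (spanned_map (g := fun x => hgen a b i * x)) => [y z|d c].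
  exact: mulrBr.
have ir : (i.+1 < size (word d))%N by rewrite size_word e; move: (ltn_ord i);
  lia.
have [u [x' [y [e' [uE dE]]]]] := word_split ir.
have dm := zeros_word d; have dn := ones_word d.
rewrite mulrA -hgE -uE.
case: (eqVneq x' y) => [xy|].
  have := shuffle_prod_flat u y e' (@hg_braided K a b r) (@hg_distant K a b r).
  rewrite -xy in dE *; rewrite -dE dm => ->; move: dm dn;
    rewrite dE !count_cat /=.
  case: x' {xy} dE => /= dE dm dn.
    rewrite -(@hecke_emb_right _ _ _ e); last by lia.
    by rewrite -mulrA -rmorphM -dE; exact: spanned_shuffle_prod.
  rewrite -(@hecke_emb_left _ _ _ e); last by lia.
  by rewrite -mulrA -rmorphM -dE; exact: spanned_shuffle_prod.
have swap : exists d' : shuffle m n, word d' = u ++ y :: x' :: e'.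
  by apply: wordP; rewrite ?(esym dm, esym dn) dE !count_cat /=; lia.
have {swap}[d' d'E] := swap.
case: x' y dE d'E => -[] // dE d'E _.
  rewrite dE -shuffle_prod_up; last exact: hg_distant.
  (* 10 is reached from 01, so that the square of the generator appears. *)
  rewrite mulrA -expr2 hg_quad; last by move: (ltn_ord i); lia.
  rewrite mulrDl -scalerAl -scalerAl mul1r shuffle_prod_up;
    last exact: hg_distant.
  rewrite -dE -d'E mulrDl -!scalerAl.
  by apply: spannedD; apply: spannedZ; exact: spanned_shuffle_prod.
rewrite dE (shuffle_prod_up u e' (@hg_distant K a b r)) -d'E;
  exact: spanned_shuffle_prod.
Qed.

(** The basis elements span, because their span is a left ideal that contains 1,
    the product attached to the sorted word. *)
Lemma hecke_span (P : H r -> Prop) :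
  P 0 -> (forall x y, P x -> P y -> P (x - y)) ->
  (forall (d : shuffle m n) c, P (T r (word d) * hecke_emb a b e c)) ->
  forall x, P x.
Proof.
move=> P0 PB PT x; suff: spanned x by exact.
elim/hecke_ind: x => [|x y|k x||i x].
- exact: spanned0.
- exact: spannedD.
- exact: spannedZ.
- have [d dE] := wordP (zeros_sorted m n) (ones_sorted m n).
  have := spanned_shuffle_prod d 1; rewrite rmorph1 mulr1 dE.
  by rewrite [T r _]shuffle_prod_sorted.
- exact: spanned_hgen.
Qed.

End Fixed.

(** * Double coset representatives as intertwiners *)

Lemma hecke_shiftD p r d (le : (d + p <= r)%N) x y :
  hecke_shift a b le (x + y) = hecke_shift a b le x + hecke_shift a b le y.
Proof. exact: raddfD. Qed.

Lemma hecke_shiftZ p r d (le : (d + p <= r)%N) k x :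
  hecke_shift a b le (k *: x) = k *: hecke_shift a b le x.
Proof. exact: linearZ. Qed.

Lemma hecke_shift_shift p r1 r2 d1 d2 d3 (le1 : (d1 + r1 <= r2)%N)
    (le2 : (d2 + p <= r1)%N) (le3 : (d3 + p <= r2)%N) x : d3 = (d1 + d2)%N ->
  hecke_shift a b le1 (hecke_shift a b le2 x) = hecke_shift a b le3 x.
Proof.
move=> d3E; elim/hecke_ind: x => [|x y IHx IHy|k x IH||i x IH].
- by rewrite !raddf0.
- by rewrite !hecke_shiftD IHx IHy.
- by rewrite !hecke_shiftZ IH.
- by rewrite !rmorph1.
rewrite !hecke_shiftM IH; congr (_ * _).
rewrite !hecke_shiftE; congr hgen.
by apply: val_inj; rewrite /= d3E addnA.
Qed.

(** It is enough to move z past generators, and then past the products of them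
    that span the algebra. *)
Lemma hecke_shift_intertwine p r d1 d2 (le1 : (d1 + p <= r)%N)
    (le2 : (d2 + p <= r)%N) z :
  (forall i, (i.+1 < p)%N -> hgen_nat a b r (d1 + i) * z =
    z * hgen_nat a b r (d2 + i)) ->
  forall x, hecke_shift a b le1 x * z = z * hecke_shift a b le2 x.
Proof.
move=> zE; elim/hecke_ind => [|x y IHx IHy|k x IH||i x IH].
- by rewrite !raddf0 mul0r mulr0.
- by rewrite !hecke_shiftD mulrDl mulrDr IHx IHy.
- by rewrite !hecke_shiftZ -scalerAl -scalerAr IH.
- by rewrite !rmorph1 mul1r mulr1.
rewrite !hecke_shiftM -mulrA IH !mulrA; congr (_ * _).
by rewrite -hgE !hecke_shift_hg // zE //; move: (ltn_ord i); lia.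
Qed.

Lemma hecke_shift2_intertwine p r1 r2 r d1 d2 d1' d2'
    (le1 : (d1 + r1 <= r)%N) (le2 : (d2 + p <= r1)%N)
    (le1' : (d1' + r2 <= r)%N) (le2' : (d2' + p <= r2)%N) z :
  (forall i, (i.+1 < p)%N ->
    hgen_nat a b r (d1 + d2 + i) * z = z * hgen_nat a b r (d1' + d2' + i)) ->
  forall x, hecke_shift a b le1 (hecke_shift a b le2 x) * z =
            z * hecke_shift a b le1' (hecke_shift a b le2' x).
Proof.
move=> zE x.
have le : (d1 + d2 + p <= r)%N by lia.
have le' : (d1' + d2' + p <= r)%N by lia.
rewrite (hecke_shift_shift le1 le2 le) // (hecke_shift_shift le1' le2' le') //.
exact: hecke_shift_intertwine.
Qed.

Section Blocks.
Variables (t s p q k l m n r : nat).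
Hypotheses (tsk : (t + s)%N = k) (pql : (p + q)%N = l).
Hypotheses (tpm : (t + p)%N = m) (sqn : (s + q)%N = n).
Hypotheses (klr : (k + l)%N = r) (mnr : (m + n)%N = r).
Local Notation Tb := (T r (blocks t s p q)).

Lemma zeros_blocks : zeros (blocks t s p q) = m.
Proof. by rewrite !count_cat !count_nseq /= -tpm; lia. Qed.

(** Inside one of the four blocks all letters are equal, so generators pass
    through; zeros keep their rank among the zeros, ones among the ones, and the
    two middle blocks change places. *)
Lemma hg_blocks u c e : blocks t s p q = u ++ c :: c :: e ->
  hgen_nat a b r (size u) * Tb =
    Tb * hgen_nat a b r (if c then m + ones u else zeros u)%N.
Proof.
move=> E; have := shuffle_prod_flat u c e (@hg_braided K a b r)
  (@hg_distant K a b r).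
by rewrite -E zeros_blocks.
Qed.

Lemma hg_block1 i : (i.+1 < t)%N -> hgen_nat a b r i * Tb =
  Tb * hgen_nat a b r i.
Proof.
move=> it; have := @hg_blocks (nseq i false) false _ _.
rewrite size_nseq count_nseq mul1n; apply.
by rewrite /blocks -(nseq_split2 false it) -catA.
Qed.

Lemma hg_block2 i : (i.+1 < s)%N ->
  hgen_nat a b r (t + i) * Tb = Tb * hgen_nat a b r (m + i).
Proof.
move=> i_s; have := @hg_blocks (nseq t false ++ nseq i true) true _ _.
rewrite size_cat !size_nseq count_cat !count_nseq mul1n mul0n add0n; apply.
by rewrite /blocks -(nseq_split2 true i_s) -!catA.
Qed.

Lemma hg_block3 i : (i.+1 < p)%N ->
  hgen_nat a b r (k + i) * Tb = Tb * hgen_nat a b r (t + i).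
Proof.
move=> ip.
have := @hg_blocks (nseq t false ++ nseq s true ++ nseq i false) false _ _.
rewrite !size_cat !size_nseq !count_cat !count_nseq !mul1n mul0n add0n addnA.
rewrite tsk; apply.
by rewrite /blocks -(nseq_split2 false ip) -!catA.
Qed.

Lemma hg_block4 i : (i.+1 < q)%N ->
  hgen_nat a b r (k + p + i) * Tb = Tb * hgen_nat a b r (m + s + i).
Proof.
move=> iq; have := @hg_blocks
  (nseq t false ++ nseq s true ++ nseq p false ++ nseq i true) true _ _.
rewrite !size_cat !size_nseq !count_cat !count_nseq !mul1n !mul0n !add0n !addnA.
rewrite tsk; apply.
by rewrite /blocks -(nseq_split2 true iq) -!catA.
Qed.

(** An element of H_t (x) H_s (x) H_p (x) H_q, embedded in H_k (x) H_l, passes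
    through the double coset representative and comes out embedded in
    H_m (x) H_n, with the two middle factors exchanged.  The four tensor
    factors are moved one by one, starting with the one next to the
    representative. *)
Lemma blocks_intertwine c :
  hecke_emb a b klr (talg_map (hecke_emb a b tsk) (hecke_emb a b pql) c) * Tb =
  Tb * hecke_emb a b mnr (talg_map (hecke_emb a b tpm) (hecke_emb a b sqn)
         (talg_swap (H t) (H s) (H p) (H q) c)).
Proof.
elim/talg4_ind: c => [|c c' IH IH'|x1 y1 x2 y2].
- by rewrite !raddf0 mul0r mulr0.
- by rewrite !raddfB mulrBl mulrBr IH IH'.
rewrite talg_swapE !talg_mapE !hecke_emb_atens !hecke_shiftM.
(* Moving from right to left leaves the middle factors in the order of the
   left-hand side; they commute in H_m (x) H_n. *)
have com := hecke_emb_comm mnr (hecke_shift a b (hecke_emb_subproofr tpm) x2)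
  (hecke_shift a b (hecke_emb_subproofl sqn) y1).
rewrite -!mulrA.
rewrite (hecke_shift2_intertwine _ _ (hecke_emb_subproofr mnr)
          (hecke_emb_subproofr sqn) hg_block4).
rewrite (mulrA _ Tb) (hecke_shift2_intertwine (z := Tb) _ _
  (hecke_emb_subproofl mnr)
          (hecke_emb_subproofr tpm)); last first.
  by move=> i ip; rewrite addn0 hg_block3.
rewrite -!mulrA (mulrA _ Tb)
  (hecke_shift2_intertwine (z := Tb) _ _ (hecke_emb_subproofr mnr)
          (hecke_emb_subproofl sqn)); last first.
  by move=> i i_s; rewrite addn0 hg_block2.
rewrite -!mulrA (mulrA _ Tb)
  (hecke_shift2_intertwine (z := Tb) _ _ (hecke_emb_subproofl mnr)
          (hecke_emb_subproofl tpm)); last first.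
  by move=> i it; rewrite hg_block1.
by rewrite -!mulrA; congr (_ * (_ * _)); rewrite !mulrA -com.
Qed.

End Blocks.

End Span.

(** * Maps out of tensor products and induced modules *)

Lemma zmod_morphismD (U V : zmodType) (f : U -> V) :
  zmod_morphism f -> {morph f : u v / u + v}.
Proof.
move=> fB u v; rewrite -{1}[v]opprK fB -[- v]sub0r fB (zmod_morphism0 fB).
by rewrite sub0r opprK.
Qed.

Section RestrictedTensor.
Variables (K : fieldType) (A A' B B' : algType K).
Variables (g : {lrmorphism A -> A'}) (h : {lrmorphism B -> B'}).
Variables (M : lmodType A') (N : lmodType B').
Local Notation gM := (resmod g M).
Local Notation hN := (resmod h N).

(** The underlying vector spaces are the same, but the scalars c act on a
    restricted module through the image of c%:A, which equals c%:A only by a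
    property of the algebra morphism.  Hence the two tensor products over K are
    related by a map and not by conversion. *)
Definition unrestrict : otensor gM hN -> otensor M N :=
  tensor_lift (fun (v : scalars gM) (w : scalars hN) => otens (v : M) (w : N)).

Definition restrict : otensor M N -> otensor gM hN :=
  tensor_lift (fun (v : scalars M) (w : scalars N) => otens (v : gM) (w : hN)).

Lemma unrestrict_bilinear : bilinear_map
  (fun (v : scalars gM) (w : scalars hN) => otens (v : M) (w : N)).
Proof.
split=> [w v v'|v w w'|c v w].
- exact: tensDl.
- exact: tensDr.
have -> : (c *: v : scalars gM) = (c *: (v : scalars M)).
  by rewrite !scalarsE -[LHS]/(g c%:A *: (v : M)) rmorph_alg.
have -> : (c *: w : scalars hN) = (c *: (w : scalars N)).
  by rewrite !scalarsE -[LHS]/(h c%:A *: (w : N)) rmorph_alg.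
exact: tens_bal.
Qed.

Lemma restrict_bilinear : bilinear_map
  (fun (v : scalars M) (w : scalars N) => otens (v : gM) (w : hN)).
Proof.
split=> [w v v'|v w w'|c v w].
- exact: tensDl.
- exact: tensDr.
have -> : (c *: v : scalars M) = (c *: (v : scalars gM)).
  by rewrite !scalarsE -[RHS]/(g c%:A *: (v : M)) rmorph_alg.
have -> : (c *: w : scalars N) = (c *: (w : scalars hN)).
  by rewrite !scalarsE -[RHS]/(h c%:A *: (w : N)) rmorph_alg.
exact: tens_bal.
Qed.

Lemma unrestrictB : zmod_morphism unrestrict.
Proof. exact: (tensor_lift_is_zmod_morphism unrestrict_bilinear). Qed.

Lemma unrestrictD : {morph unrestrict : u v / u + v}.
Proof. exact: (tensor_liftD unrestrict_bilinear). Qed.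

Lemma restrictB : zmod_morphism restrict.
Proof. exact: (tensor_lift_is_zmod_morphism restrict_bilinear). Qed.

Lemma unrestrictE (v : M) (w : N) :
  unrestrict (otens (v : gM) (w : hN)) = otens v w.
Proof. exact: (tensor_liftE unrestrict_bilinear). Qed.

Lemma restrictE (v : M) (w : N) :
  restrict (otens v w) = otens (v : gM) (w : hN).
Proof. exact: (tensor_liftE restrict_bilinear). Qed.

Lemma restrictK : cancel restrict unrestrict.
Proof.
elim/otensor_ind => [|u u' IH IH'|v w].
- by rewrite (zmod_morphism0 restrictB) (zmod_morphism0 unrestrictB).
- by rewrite restrictB unrestrictB IH IH'.
- by rewrite restrictE unrestrictE.
Qed.

Lemma unrestrictK : cancel unrestrict restrict.
Proof.
elim/otensor_ind => [|u u' IH IH'|v w].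
- by rewrite (zmod_morphism0 unrestrictB) (zmod_morphism0 restrictB).
- by rewrite unrestrictB restrictB IH IH'.
- by rewrite unrestrictE restrictE.
Qed.

Lemma unrestrictZ (t : A \ot B) u :
  unrestrict (t *: u) = talg_map g h t *: unrestrict u.
Proof.
elim/talg_ind: t => [|s t IH IH'|x y].
- by rewrite raddf0 !scale0r (zmod_morphism0 unrestrictB).
- by rewrite raddfB !scalerBl unrestrictB IH IH'.
elim/otensor_ind: u => [|u u' IH IH'|v w].
- by rewrite scaler0 (zmod_morphism0 unrestrictB) scaler0.
- by rewrite scalerBr !unrestrictB IH IH' scalerBr.
by rewrite otensZ talg_mapE !unrestrictE otensZ.
Qed.

End RestrictedTensor.

Section InductionLift.
Variables (A B : nzRingType) (f : {rmorphism B -> A}) (V : lmodType B).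
Implicit Types (x y : A) (c : B) (v w : V).

Lemma indtensZ x c v : indtens f (x * f c) v = indtens f x (c *: v).
Proof. exact: btens_bal. Qed.

Lemma indtensBl v : zmod_morphism (fun x => indtens f x v).
Proof.
by move=> x y; apply/eqP; rewrite eq_sym subr_eq -[X in _ == X]btensDl addrNK.
Qed.

Lemma indtensBr x : zmod_morphism (fun v => indtens f x v).
Proof.
by move=> v w; apply/eqP; rewrite eq_sym subr_eq -[X in _ == X]btensDr addrNK.
Qed.

Lemma indtens0l v : indtens f 0 v = 0.
Proof. exact: (zmod_morphism0 (indtensBl v)). Qed.

Lemma indtens_act x y v : x *: indtens f y v = indtens f (x * y) v.
Proof. exact: indmod_scaleE. Qed.

Lemma indmod_ind (P : indmod f V -> Prop) :
  P 0 -> (forall u u', P u -> P u' -> P (u - u')) ->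
  (forall x v, P (indtens f x v)) -> forall u, P u.
Proof. exact: btensor_ind. Qed.

Variables (G : zmodType) (phi : A -> V -> G).

Definition ind_lift (u : indmod f V) : G := btensor_lift phi u.

Hypothesis phiDl : forall v, {morph phi^~ v : x y / x + y}.
Hypothesis phiDr : forall x, {morph phi x : v w / v + w}.
Hypothesis phiZ : forall x c v, phi (x * f c) v = phi x (c *: v).

Lemma ind_lift_balanced :
  balanced (fun c x => x * f c) (fun c v => c *: v) phi.
Proof. by split. Qed.

Lemma ind_liftE x v : ind_lift (indtens f x v) = phi x v.
Proof. exact: (btensor_liftE ind_lift_balanced). Qed.

Lemma ind_liftB : zmod_morphism ind_lift.
Proof. exact: (btensor_lift_is_zmod_morphism ind_lift_balanced). Qed.

End InductionLift.

(** * Direct sums from compatible bases *)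

Section CosetSummand.
Variables (K : fieldType) (At As Ap Aq Ck Cl Bm Bn : algType K).
Variables (ek : {lrmorphism At \ot As -> Ck})
  (el : {lrmorphism Ap \ot Aq -> Cl}).
Variables (em : {lrmorphism At \ot Ap -> Bm})
  (en : {lrmorphism As \ot Aq -> Bn}).
Variables (M : lmodType Bm) (N : lmodType Bn).

(** What the functor T_(t,s) makes of the restriction of M and N, for arbitrary
    algebras in the place of Hecke algebras. *)
Definition swap_module : lmodType ((At \ot As) \ot (Ap \ot Aq)) :=
  resmod (talg_swap At As Ap Aq) (otensor (resmod em M) (resmod en N)).

Definition coset_summand : lmodType (Ck \ot Cl) :=
  indmod (talg_map ek el) swap_module.

End CosetSummand.

Lemma eq_dirsum_iso (A : nzRingType) (I : finType) (U : lmodType A)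
    (V V' : I -> lmodType A) : (forall i, V i = V' i) ->
  lmod_iso U (dirsum V') -> lmod_iso U (dirsum V).
Proof. by move=> /funext ->. Qed.

Section BasisDecomposition.
Variables (A : nzRingType) (I D : finType) (iota : D -> I).
Variables (box : lmodType A) (S : I -> lmodType A) (V : zmodType).
Variables (b : D -> V -> box) (c : D -> box -> V).
Variables (st : forall i, D -> V -> S i) (to : forall i, S i -> box).
Hypothesis cB : forall d, zmod_morphism (c d).
Hypothesis cb : forall d d' v, c d (b d' v) = if d == d' then v else 0.
Hypothesis box_ind : forall P : box -> Prop,
  P 0 -> (forall u u', P u -> P u' -> P (u - u')) ->
  (forall d v, P (b d v)) -> forall u, P u.
Hypothesis stB : forall i d, zmod_morphism (st i d).
Hypothesis S_ind : forall i (P : S i -> Prop),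
  P 0 -> (forall u u', P u -> P u' -> P (u - u')) ->
  (forall d v, iota d = i -> P (st i d v)) -> forall u, P u.
Hypothesis toB : forall i, zmod_morphism (@to i).
Hypothesis toZ : forall i, scalable (@to i).
Hypothesis to_st : forall i d v, iota d = i -> to (st i d v) = b d v.

Definition from i (u : box) : S i := \sum_(d | iota d == i) st i d (c d u).

Lemma fromB i : zmod_morphism (from i).
Proof. by move=> u v; rewrite -sumrB; apply: eq_bigr => d _;
  rewrite cB stB. Qed.

Lemma from_b i d v : from i (b d v) = if iota d == i then st i d v else 0.
Proof.
have E0 d' : d' != d -> st i d' (c d' (b d v)) = 0.
  by move=> /negPf d'd; rewrite cb d'd (zmod_morphism0 (stB i d')).
case: ifP => di.
  rewrite /from (bigD1 d) //= big1 ?addr0 => [|d' /andP[_]]; last exact: E0.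
  by rewrite cb eqxx.
by rewrite /from big1 // => d' d'i; apply: E0; apply: contraFneq di => <-.
Qed.

Lemma from_to i i' (u : S i') : i' != i -> from i (to u) = 0.
Proof.
move=> ii'; elim/(@S_ind i'): u => [|u u' IH IH'|d v di].
- by rewrite (zmod_morphism0 (@toB i')) (zmod_morphism0 (@fromB i)).
- by rewrite toB fromB IH IH' subr0.
- by rewrite to_st // from_b di (negPf ii').
Qed.

Lemma toK i : cancel (@to i) (from i).
Proof.
elim/(@S_ind i) => [|u u' IH IH'|d v di].
- by rewrite (zmod_morphism0 (@toB i)) (zmod_morphism0 (@fromB i)).
- by rewrite toB fromB IH IH'.
- by rewrite to_st // from_b di eqxx.
Qed.

Definition sum_to (u : dirsum S) : box := \sum_i to (u i).
Definition all_from (u : box) : dirsum S := [ffun i => from i u].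

Lemma sum_toK : cancel sum_to all_from.
Proof.
move=> u; apply/ffunP => i; rewrite ffunE /sum_to.
have -> : from i (\sum_i' to (u i')) = \sum_i' from i (to (u i')).
  elim/big_rec2: _ => [|i' x y _ <-]; first exact: zmod_morphism0 (@fromB i).
  exact: zmod_morphismD (@fromB i) _ _.
by rewrite (bigD1 i) //= toK big1 ?addr0 // => i' ii'; exact: from_to.
Qed.

Lemma all_fromK : cancel all_from sum_to.
Proof.
move=> u; have -> : sum_to (all_from u) = \sum_i to (from i u).
  by apply: eq_bigr => i _; rewrite ffunE.
elim/box_ind: u => [|u u' IH IH'|d v].
- by apply: big1 => i _; rewrite (zmod_morphism0 (@fromB i))
  (zmod_morphism0 (@toB i)).
- transitivity (\sum_i to (from i u) - \sum_i to (from i u')); last first.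
    by rewrite IH IH'.
  by rewrite -sumrB; apply: eq_bigr => i _; rewrite fromB toB.
rewrite (bigD1 (iota d)) //= from_b eqxx to_st //.
rewrite big1 ?addr0 // => i id; rewrite from_b eq_sym (negPf id).
exact: zmod_morphism0 (@toB i).
Qed.

Lemma sum_to_linear : linear sum_to.
Proof.
move=> x u u'; rewrite /sum_to scaler_sumr -big_split /=.
apply: eq_bigr => i _; rewrite !ffunE.
by rewrite (zmod_morphismD (@toB i)) toZ.
Qed.

(** Here [box] has coordinates on D, and S_i is spanned by the part of D above
    i.  Maps S_i -> box that carry spanning elements to basis elements are
    injective, and together they hit every basis element once; hence [box] is
    the direct sum of the S_i.  The inverse sends u to the sum of its
    coordinates placed in S_i, over the part of D above i. *)
Lemma basis_decomposition : lmod_iso box (dirsum S).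
Proof.
pose F : {linear dirsum S -> box} :=
  HB.pack sum_to (GRing.isLinear.Build _ _ _ _ sum_to sum_to_linear).
have GL : linear all_from by exact: (@can2_linear _ _ _ F _ sum_toK all_fromK).
pose G : {linear box -> dirsum S} :=
  HB.pack all_from (GRing.isLinear.Build _ _ _ _ all_from GL).
by exists G; exists sum_to; [exact: all_fromK | exact: sum_toK].
Qed.

End BasisDecomposition.

(** * The double coset decomposition over arbitrary algebras *)

Section DoubleCoset.
Variables (K : fieldType) (At As Ap Aq Ck Cl Bm Bn R : algType K).
Variables (ek : {lrmorphism At \ot As -> Ck})
  (el : {lrmorphism Ap \ot Aq -> Cl}).
Variables (em : {lrmorphism At \ot Ap -> Bm})
  (en : {lrmorphism As \ot Aq -> Bn}).
Variables (f : {lrmorphism Bm \ot Bn -> R}) (fe : {lrmorphism Ck \ot Cl -> R}).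
Variables (M : lmodType Bm) (N : lmodType Bn) (z : R).
Local Notation sw := (talg_swap At As Ap Aq).
Hypothesis zE : forall c,
  fe (talg_map ek el c) * z = z * f (talg_map em en (sw c)).
Local Notation W := (resmod sw (otensor (resmod em M) (resmod en N))).
Local Notation box := (indmod f (otensor M N)).
Local Notation j := (talg_map ek el).
Local Notation S := (indmod j W).

Definition swap_in (u : otensor M N) : W := restrict em en u.
Definition swap_out (v : W) : otensor M N := unrestrict v.

Lemma swap_inB : zmod_morphism swap_in.
Proof. exact: restrictB. Qed.

Lemma swap_outD : {morph swap_out : u v / u + v}.
Proof. exact: unrestrictD. Qed.

Lemma swap_outZ c v : swap_out (c *: v) = talg_map em en (sw c) *: swap_out v.
Proof. exact: unrestrictZ. Qed.

Lemma swap_inK : cancel swap_in swap_out.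
Proof. exact: restrictK. Qed.

Lemma swap_outK : cancel swap_out swap_in.
Proof. exact: unrestrictK. Qed.

(** The map x (x) v |-> x z (x) v.  An element of the subalgebra that is moved
    across the tensor product on the left has to pass z on the right; this is
    possible because z intertwines the two embeddings, up to the exchange of
    the middle factors. *)
Definition double_coset_map : S -> box :=
  ind_lift (fun x (v : W) => indtens f (fe x * z) (swap_out v)).

Let phiDl (v : W) :
  {morph (fun x => indtens f (fe x * z) (swap_out v)) : x y / x + y}.
Proof. by move=> x y; rewrite raddfD mulrDl; exact: btensDl. Qed.

Let phiDr x :
  {morph (fun v : W => indtens f (fe x * z) (swap_out v)) : v w / v + w}.
Proof. by move=> v w; rewrite swap_outD; exact: btensDr. Qed.

Let phiZ x c (v : W) : indtens f (fe (x * j c) * z) (swap_out v) =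
  indtens f (fe x * z) (swap_out (c *: v)).
Proof. by rewrite (rmorphM fe) -mulrA zE mulrA indtensZ swap_outZ. Qed.

Lemma double_coset_mapE x v :
  double_coset_map (indtens j x v) = indtens f (fe x * z) (swap_out v).
Proof. exact: (ind_liftE phiDl phiDr phiZ). Qed.

Lemma double_coset_mapB : zmod_morphism double_coset_map.
Proof. exact: (ind_liftB phiDl phiDr phiZ). Qed.

Lemma double_coset_map0 : double_coset_map 0 = 0.
Proof. exact: (zmod_morphism0 double_coset_mapB). Qed.

Lemma double_coset_mapZ x u : double_coset_map (x *: u) =
  fe x *: double_coset_map u.
Proof.
elim/indmod_ind: u => [|u u' IH IH'|y v].
- by rewrite scaler0 double_coset_map0 scaler0.
- by rewrite scalerBr !double_coset_mapB IH IH' scalerBr.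
by rewrite double_coset_mapE !indtens_act double_coset_mapE (rmorphM fe) mulrA.
Qed.

End DoubleCoset.

Section DoubleCosetDecomposition.
Variables (K : fieldType) (I D : finType).
Variables (At As Ap Aq : I -> algType K) (Ck Cl Bm Bn R : algType K).
Variables (ek : forall i, {lrmorphism At i \ot As i -> Ck})
  (el : forall i, {lrmorphism Ap i \ot Aq i -> Cl})
  (em : forall i, {lrmorphism At i \ot Ap i -> Bm})
  (en : forall i, {lrmorphism As i \ot Aq i -> Bn}).
Variables (f : {lrmorphism Bm \ot Bn -> R}) (fe : {lrmorphism Ck \ot Cl -> R}).
Variables (z : I -> R) (tau : D -> R) (coord : D -> R -> Bm \ot Bn).
Variables (iota : D -> I) (x : D -> Ck \ot Cl).
Local Notation j i := (talg_map (ek i) (el i)).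
Local Notation sw i := (talg_swap (At i) (As i) (Ap i) (Aq i)).

Hypothesis zE : forall i c,
  fe (j i c) * z i = z i * f (talg_map (em i) (en i) (sw i c)).
Hypothesis tauE : forall d, fe (x d) * z (iota d) = tau d.
Hypothesis coordD : forall d, {morph coord d : r r' / r + r'}.
Hypothesis coordMr : forall d r c, coord d (r * f c) = coord d r * c.
Hypothesis coord_tau : forall d d', coord d (tau d') = if d == d' then 1 else 0.
Hypothesis R_span : forall P : R -> Prop,
  P 0 -> (forall r r', P r -> P r' -> P (r - r')) ->
  (forall d c, P (tau d * f c)) -> forall r, P r.
Hypothesis C_span : forall i (P : Ck \ot Cl -> Prop),
  P 0 -> (forall y y', P y -> P y' -> P (y - y')) ->
  (forall d c, iota d = i -> P (x d * j i c)) -> forall y, P y.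

Variables (M : lmodType Bm) (N : lmodType Bn).
Local Notation V := (otensor M N).
Local Notation box := (indmod f V).
Local Notation W i := (resmod (sw i)
  (otensor (resmod (em i) M) (resmod (en i) N))).
Local Notation S i := (indmod (j i) (W i)).
Local Notation to_box i :=
  (@double_coset_map K _ _ _ _ _ _ _ _ _ (ek i) (el i) (em i) (en i) f fe M N
    (z i)).
Local Notation sw_in i := (@swap_in K _ _ _ _ _ _ (em i) (en i) M N).
Local Notation sw_out i := (@swap_out K _ _ _ _ _ _ (em i) (en i) M N).

Definition ind_coord d : box -> V := ind_lift (fun r (v : V) => coord d r *: v).

Let coord_Dl d (v : V) : {morph (fun r => coord d r *: v) : r r' / r + r'}.
Proof. by move=> r r'; rewrite coordD scalerDl. Qed.

Let coord_Dr d r : {morph (fun v : V => coord d r *: v) : v w / v + w}.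
Proof. exact: scalerDr. Qed.

Let coord_Z d r c (v : V) : coord d (r * f c) *: v = coord d r *: (c *: v).
Proof. by rewrite coordMr scalerA. Qed.

Lemma ind_coordB d : zmod_morphism (ind_coord d).
Proof. exact: (ind_liftB (coord_Dl d) (coord_Dr d) (coord_Z d)). Qed.

Lemma ind_coord_tau d d' (v : V) :
  ind_coord d (indtens f (tau d') v) = if d == d' then v else 0.
Proof.
rewrite [LHS](ind_liftE (coord_Dl d) (coord_Dr d) (coord_Z d)) coord_tau.
by case: ifP => _; rewrite ?scale1r ?scale0r.
Qed.

Lemma box_ind (P : box -> Prop) :
  P 0 -> (forall u u', P u -> P u' -> P (u - u')) ->
  (forall d v, P (indtens f (tau d) v)) -> forall u, P u.
Proof.
move=> P0 PB PT; elim/indmod_ind => // r v.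
elim/R_span: r v => [v|r r' IH IH' v|d c v].
- by rewrite indtens0l.
- by rewrite indtensBl; exact: PB.
- by rewrite indtensZ.
Qed.

Lemma summand_ind i (P : S i -> Prop) :
  P 0 -> (forall u u', P u -> P u' -> P (u - u')) ->
  (forall d v, iota d = i -> P (indtens (j i) (x d) v)) -> forall u, P u.
Proof.
move=> P0 PB PT; elim/indmod_ind => // y v.
elim/(@C_span i): y v => [v|y y' IH IH' v|d c di v].
- by rewrite indtens0l.
- by rewrite indtensBl; exact: PB.
- by rewrite indtensZ; exact: PT.
Qed.

(** If the basis elements tau_d of R over Bm (x) Bn factor as x_d z_i, with i
    determined by d, and the x_d above i generate Ck (x) Cl over the i-th
    subalgebra, then the induced module splits along the z_i. *)
Theorem double_coset_decomposition :
  lmod_iso (resmod fe box) (dirsum (fun i => S i)).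
Proof.
apply: (@basis_decomposition (Ck \ot Cl) I D iota (resmod fe box) (fun i => S i)
  V
  (fun d v => indtens f (tau d) v) ind_coord
  (fun i d v => indtens (j i) (x d) (sw_in i v)) (fun i => to_box i)).
- exact: ind_coordB.
- exact: ind_coord_tau.
- exact: box_ind.
- by move=> i d u v; rewrite swap_inB indtensBr.
- move=> i P P0 PB PT; apply: summand_ind => // d v di.
  have vK := swap_outK v.
  have := PT d (sw_out i v) di.
  by rewrite vK.
- move=> i; exact: (double_coset_mapB (@zE i)).
- move=> i c u; exact: (double_coset_mapZ (@zE i)).
move=> i d v di; have <- : fe (x d) * z i = tau d by rewrite -di tauE.
have E := double_coset_mapE (@zE i) (x d) (sw_in i v).
have vK := @swap_inK K _ _ _ _ _ _ (em i) (en i) M N v.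
rewrite vK in E.
exact E.
Qed.

Corollary coset_summand_decomposition : lmod_iso (resmod fe box)
  (dirsum (fun i => coset_summand (ek i) (el i) (em i) (en i) M N)).
Proof. exact: double_coset_decomposition. Qed.

End DoubleCosetDecomposition.

(** * The Mackey formula for Hecke algebras *)

Section SummandForm.
Variables (K : closedFieldType) (a b : K) (m n : nat).
Local Notation H := (hecke a b).
Variables (M : lmodType (H m)) (N : lmodType (H n)).

(** Both sides are the same by definition; the statement is kept for arbitrary
    morphisms so that it holds without looking inside the embeddings. *)
Lemma middle_swap_summand t s p q k l
    (em : {lrmorphism H t \ot H p -> H m})
      (en : {lrmorphism H s \ot H q -> H n})
    (ek : {lrmorphism H t \ot H s -> H k})
      (el : {lrmorphism H p \ot H q -> H l}) :
  (indmod (talg_map ek el) (middle_swap (otensor (resmod em M) (resmod en N))) :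
    lmodType (H k \ot H l)) = coset_summand ek el em en M N.
Proof. exact (erefl _). Qed.

Lemma mackey_summandE k t s (tm : (t <= m)%N) (sn : (s <= n)%N)
    (tsk : (t + s)%N = k) :
  mackey_summand tm sn tsk M N =
  coset_summand (hecke_emb a b tsk) (hecke_emb a b (mackey_subproof tm sn tsk))
    (hecke_emb a b (subnKC tm)) (hecke_emb a b (subnKC sn)) M N.
Proof. rewrite -middle_swap_summand; reflexivity. Qed.

End SummandForm.

Section Mackey.
Variables (K : closedFieldType) (a b : K) (m n k : nat).
Local Notation H := (hecke a b).
Local Notation T r := (shuffle_prod (hgen_nat a b r)).
Local Notation l := (m + n - k)%N.
Variables (e : (k + l)%N = (m + n)%N).
Local Notation fe := (hecke_emb a b e).

Lemma hecke_emb_prod (w1 w2 : seq bool) : size w1 = k -> size w2 = l ->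
  fe (atens (T k w1) (T l w2)) =
  T (m + n) w1 * shuffle_prod (fun i => hgen_nat a b (m + n) (k + i)) w2.
Proof.
move=> w1k w2l; rewrite hecke_emb_atens.
have Ts p d (le : (d + p <= m + n)%N) w : size w = p ->
    hecke_shift a b le (T p w) =
      shuffle_prod (fun i => hgen_nat a b (m + n) (d + i)) w.
  move=> wp; rewrite rmorph_shuffle_prod; apply: eq_shuffle_prod => i;
    rewrite wp => ip.
  exact: hecke_shift_hg.
by rewrite !Ts.
Qed.

Lemma size_take_word (d : shuffle m n) : size (take k (word d)) = k.
Proof. by rewrite size_takel // size_word -e leq_addr. Qed.

Lemma size_drop_word (d : shuffle m n) : size (drop k (word d)) = l.
Proof. by rewrite size_drop size_word. Qed.

Lemma count_take_word c (d : shuffle m n) :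
  (count_mem c (take k (word d)) <= count_mem c (word d))%N.
Proof. by rewrite -{2}(cat_take_drop k (word d)) count_cat leq_addr. Qed.

Lemma split_index_subproof (d : shuffle m n) :
  let ts : 'I_m.+1 * 'I_n.+1 :=
    (inord (zeros (take k (word d))), inord (ones (take k (word d)))) in
  (ts.1 + ts.2 == k)%N.
Proof.
have := count_take_word false d; have := count_take_word true d.
rewrite zeros_word ones_word => le_n le_m.
by rewrite /= !inordK ?ltnS // size_zeros_ones size_take_word.
Qed.

(** The double coset of a shuffle: how many letters of each kind come before the
    cut. *)
Definition split_index (d : shuffle m n) : mackey_index m n k :=
  exist (fun ts : 'I_m.+1 * 'I_n.+1 => ts.1 + ts.2 == k)%N _
    (split_index_subproof d).

Lemma split_indexE d : ((val (split_index d)).1 =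
  zeros (take k (word d)) :> nat) *
  ((val (split_index d)).2 = ones (take k (word d)) :> nat).
Proof.
have := count_take_word false d; have := count_take_word true d.
by rewrite zeros_word ones_word => le_n le_m; rewrite /= !inordK ?ltnS.
Qed.

Lemma split_indexP d (i : mackey_index m n k) :
  zeros (take k (word d)) = (val i).1 -> split_index d = i.
Proof.
move=> zi; have oi : ones (take k (word d)) = (val i).2.
  apply: (@addnI (val i).1); rewrite -{1}zi size_zeros_ones size_take_word.
  exact/esym/eqP/(valP i).
have [z1 o1] := split_indexE d.
apply: val_inj; apply: injective_projections; apply: val_inj.
  exact: etrans z1 zi.
exact: etrans o1 oi.
Qed.

Local Notation ti i := (nat_of_ord (val i).1).
Local Notation si i := (nat_of_ord (val i).2).

Definition split_prod (d : shuffle m n) : H k \ot H l :=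
  atens (T k (take k (word d))) (T l (drop k (word d))).

Definition block_prod (i : mackey_index m n k) : H (m + n) :=
  T (m + n) (blocks (ti i) (si i) (m - ti i) (n - si i)).

(** The factorization of shuffle_prod_cat at the place k: after the cut there
    remain the letters 0 and 1 that were not used before it. *)
Lemma split_prodE d : fe (split_prod d) * block_prod (split_index d) =
  T (m + n) (word d).
Proof.
rewrite -[in RHS](cat_take_drop k (word d)) shuffle_prod_cat;
  last exact: hg_distant.
rewrite hecke_emb_prod ?size_take_word ?size_drop_word //; congr (_ * _).
have dropE c : count_mem c (drop k (word d)) =
    (count_mem c (word d) - count_mem c (take k (word d)))%N.
  by rewrite -{2}(cat_take_drop k (word d)) count_cat addKn.
by rewrite /block_prod !split_indexE !dropE zeros_word ones_word.
Qed.

Section Span.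
Variable i : mackey_index m n k.
Local Notation tsk := (eqP (valP i)).
Local Notation tm := (leq_ord (val i).1).
Local Notation sn := (leq_ord (val i).2).
Local Notation pq := (mackey_subproof tm sn tsk).
Local Notation j := (talg_map (hecke_emb a b tsk) (hecke_emb a b pq)).

(** Spanning in each of the two tensor factors; a pair of shuffles for the two
    halves is the same as a shuffle d cut at k whose index is i. *)
Lemma split_span (P : H k \ot H l -> Prop) :
  P 0 -> (forall y y', P y -> P y' -> P (y - y')) ->
  (forall d c, split_index d = i -> P (split_prod d * j c)) -> forall y, P y.
Proof.
move=> P0 PB PT; elim/talg_ind => // y y'.
elim/(@hecke_span K a b _ _ _ tsk): y => [|y1 y2 IH IH'|w1 c].
- by rewrite (zmod_morphism0 (atensBl _)).
- by rewrite (atensBl _); exact: PB.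
elim/(@hecke_span K a b _ _ _ pq): y' => [|y1 y2 IH IH'|w2 c'].
- by rewrite (zmod_morphism0 (atensBr _)).
- by rewrite (atensBr _); exact: PB.
have [d dE] : exists d : shuffle m n, word d = word w1 ++ word w2.
  by apply: wordP; rewrite count_cat ?zeros_word ?ones_word subnKC ?leq_ord.
have w1k : k = size (word w1) by rewrite size_word; exact/esym/eqP/(valP i).
have := PT d (atens c c'); rewrite talg_mapE /split_prod atensM dE.
rewrite take_size_cat // drop_size_cat //; apply; apply: split_indexP.
by rewrite dE take_size_cat // zeros_word.
Qed.

End Span.

Theorem hecke_mackey (M : lmodType (H m)) (N : lmodType (H n)) :
  lmod_iso (resmod fe (boxtimes M N))
    (dirsum (fun ts : mackey_index m n k =>
       mackey_summand (leq_ord (val ts).1) (leq_ord (val ts).2)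
         (eqP (valP ts)) M N)).
Proof.
apply: eq_dirsum_iso => [i|]; first exact: mackey_summandE.
apply: (@coset_summand_decomposition _ _ (shuffle m n) _ _ _ _ _ _ _ _ _ _ _ _ _
  _ _
  block_prod (fun d => T (m + n) (word d)) (@coord K a b m n) split_index
    split_prod).
- move=> i c; exact: blocks_intertwine.
- exact: split_prodE.
- exact: coordD.
- exact: coordMr.
- exact: coord_shuffle_prod.
- exact: hecke_span.
- exact: split_span.
Qed.

End Mackey.

Theorem corollary3p6 (R : realType) (a b : R[i]) (m n k : nat)
    (m_ge1 : (1 <= m)%N) (n_ge1 : (1 <= n)%N)
    (k_bound : (1 <= k <= m + n - 1)%N)
    (M : lmodType (hecke a b m)) (N : lmodType (hecke a b n)) :
  lmod_iso
    (resmod (hecke_emb a b (mackey_bound k_bound)) (boxtimes M N))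
    (dirsum (fun ts : mackey_index m n k =>
       mackey_summand (leq_ord (val ts).1) (leq_ord (val ts).2)
         (eqP (valP ts)) M N)).
Proof. exact: hecke_mackey. Qed.
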